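(* Let $(\Omega,\mathcal{F},\mathbb{P})$ be a nonatomic probability space. Let $\mathcal{A}\subset L^\infty$ be a convex, law-invariant acceptance set and let $S=(S_0,S_T)$ be a traded asset with $S_T\in L^\infty$. Assume $\rho_{\mathcal{A},S}$ is finite-valued (hence continuous) on $L^\infty$. For every $1\le p<\infty$, the following statements are equivalent: (a) $\rho_{\mathcal{A},S}$ can be extended to a finite-valued (hence continuous) risk measure on $L^p$; (b) if $(X_n)\subset L^\infty$ and $X_n\to0$ in $L^p$, then $\rho_{\mathcal{A},S}(X_n)\to\rho_{\mathcal{A},S}(0)$; (c) $\mathrm{Cl}_\infty(\mathcal{A})$ has nonempty interior with respect to the relative topology induced on $L^\infty$ by the $L^p$-norm; (d) $\mathrm{Cl}_p(\mathcal{A})$ has nonempty interior in $L^p$. In this case, the extension is unique and is given by $\rho_{\mathrm{Cl}_p(\mathcal{A}),S}$ on $L^p$.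
   Context: $L^p=L^p(\Omega,\mathcal{F},\mathbb{P})$, $1\le p\le\infty$, with norm $\|\cdot\|_p$ and the almost-sure order; $L^p_+$ is its positive cone. An acceptance set in $L^p$ is a nonempty proper subset $\mathcal{A}$ with $\mathcal{A}+L^p_+\subset\mathcal{A}$. $\mathcal{A}$ is law-invariant if $X\in\mathcal{A}$ whenever $X$ has the same law as some $Y\in\mathcal{A}$. A traded asset is $S=(S_0,S_T)$ with $S_0>0$ and $S_T\ge0$ nonzero. For a set $\mathcal{B}\subset L^p$, $\rho_{\mathcal{B},S}(X)=\inf\{m\in\mathbb{R}: X+\frac{m}{S_0}S_T\in\mathcal{B}\}$ for $X\in L^p$. A risk measure on $L^p$ means a map of this form. $\mathrm{Cl}_\infty(\mathcal{A})$ and $\mathrm{Cl}_p(\mathcal{A})$ denote the closures of $\mathcal{A}$ in $L^\infty$ and in $L^p$ respectively.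
   Formalization: In (a) and in the uniqueness claim the extending risk measure is required to come from a convex acceptance set in L^p; without convexity a finite-valued extension need be neither continuous nor unique. Continuity of the extension is not stated separately. *)

(* Defs.v *)
(* L^p spaces are represented by their
   representatives: real-valued measurable functions with finite L^p norm
   ('N[P]_p from hoelder.v); all set-level notions below are required to be
   compatible with P-a.s. equality, which models working in the quotient. *)
From HB Require Import structures.
From mathcomp Require Import all_boot all_order all_algebra.
From mathcomp Require Import all_classical all_reals.
From mathcomp Require Import ereal topology normedtype sequences measure.
From mathcomp Require Import lebesgue_measure measurable_realfun lebesgue_integral probability hoelder.
Set Implicit Arguments.
Unset Strict Implicit.
Unset Printing Implicit Defensive.
Import Order.TTheory GRing.Theory Num.Theory.
Local Open Scope classical_set_scope.
Local Open Scope ring_scope.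

Section Defs.
Context {d : measure_display} {T : measurableType d} {R : realType}.
Variable P : probability T R.

Definition nonatomic : Prop :=
  forall A : set T, measurable A -> (0 < P A)%E ->
    exists B : set T, [/\ measurable B, B `<=` A, (0 < P B)%E & (P B < P A)%E].

Definition Lp (p : \bar R) : set (T -> R) :=
  [set f : T -> R | measurable_fun setT f /\ finite_norm P p f].

Definition Ldist (p : \bar R) (X Y : T -> R) : \bar R :=
  ('N[P]_p [EFin \o (fun w => (X w - Y w)%R)])%E.

Definition acceptance_set (p : \bar R) (A : set (T -> R)) : Prop :=
  [/\ A `<=` Lp p,
      exists X, A X,
      exists X, Lp p X /\ ~ A X &
      forall X Y, A X -> Lp p Y -> {ae P, forall w, X w <= Y w} -> A Y].

Definition convex_set (A : set (T -> R)) : Prop :=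
  forall X Y (l : R), A X -> A Y -> 0 <= l <= 1 ->
    A (fun w => l * X w + (1 - l) * Y w).

Definition same_law (X Y : T -> R) : Prop :=
  forall B : set R, measurable B -> P (X @^-1` B) = P (Y @^-1` B).

Definition law_invariant (p : \bar R) (A : set (T -> R)) : Prop :=
  forall X Y, Lp p X -> A Y -> same_law X Y -> A X.

Definition traded_asset (S0 : R) (ST : T -> R) : Prop :=
  [/\ 0 < S0, measurable_fun setT ST, {ae P, forall w, 0 <= ST w}
    & ~ {ae P, forall w, ST w = 0}].

Definition rho (B : set (T -> R)) (S0 : R) (ST : T -> R) (X : T -> R)
  : \bar R :=
  ereal_inf [set (m%:E)%E | m in [set m : R | B (fun w => X w + m / S0 * ST w)]].

Definition Lclosure (p : \bar R) (A : set (T -> R)) : set (T -> R) :=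
  [set X | Lp p X /\ forall e : R, 0 < e ->
     exists Y, A Y /\ (Ldist p X Y < e%:E)%E].

Definition has_interior (q p : \bar R) (C : set (T -> R)) : Prop :=
  exists X, C X /\ exists e : R, 0 < e /\
    forall Y, Lp q Y -> (Ldist p Y X < e%:E)%E -> C Y.

End Defs.

Section Ext.
Context {d : measure_display} {T : measurableType d} {R : realType}.
Variable P : probability T R.

Definition finite_extension (p : \bar R) (A B : set (T -> R)) (S0 : R)
    (ST : T -> R) : Prop :=
  [/\ acceptance_set P p B, convex_set B,
      (forall X, Lp P p X -> rho B S0 ST X \is a fin_num)
    & (forall X, Lp P +oo%E X -> rho B S0 ST X = rho A S0 ST X)].
End Ext.

(* Main.v *)
(* Write F for the finite part of rho_A, a convex antitone functional on L^oo.
   Three facts drive the proof.  First, Cl_p(A) and L^oo meet exactly in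
   Cl_oo(A): cut a set E into N equiprobable pieces along quantiles of X and
   dominate X on E by a function constant on each piece; its cyclic shifts have
   the same law, hence lie in A, and they average to a constant within O(1/N) of
   the mean of X on E.  So A is stable under conditional means over finite
   partitions up to small constants, and such means turn L^p-convergence into
   uniform convergence on the level sets of a bounded limit.  Second, a finite
   convex antitone functional on L^p is continuous (Namioka-Klee).  Third, a
   convex functional bounded above on a ball is continuous.  Since
   Cl_oo(A) = {F <= 0}, these give the equivalences; uniqueness follows from
   continuity and the density of L^oo in L^p. *)

Require Import Defs.
From HB Require Import structures.
From mathcomp Require Import all_boot all_order all_algebra.
From mathcomp Require Import all_classical all_reals.
From mathcomp Require Import ereal topology normedtype sequences measure.
From mathcomp Require Import lebesgue_measure measurable_realfun lebesgue_integral probability hoelder.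
From mathcomp Require Import ess_sup_inf exp.
From mathcomp Require Import ring lra.
Import Order.TTheory GRing.Theory Num.Theory.
Local Open Scope classical_set_scope.
Local Open Scope ring_scope.

Set Implicit Arguments.
Unset Strict Implicit.
Unset Printing Implicit Defensive.

(** * Spaces of p-integrable functions *)

Section LpSpaces.
Context {d : measure_display} {T : measurableType d} {R : realType}.
Variable P : probability T R.
Implicit Types (X Y Z : T -> R) (q : \bar R) (p : R).

Lemma LpE q X : Lp P q X <-> X \in Lfun P q.
Proof.
by split=> [[mX fX]|/andP[]]; [apply/andP; split; rewrite inE|rewrite !inE].
Qed.

Lemma Lp_lincomb q X Y (a b : R) : (1 <= q)%E -> Lp P q X -> Lp P q Y ->
  Lp P q (fun w => a * X w + b * Y w).
Proof.
move=> q1 /LpE LX /LpE LY; apply/LpE.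
have [_ H] := Lfun_submod_closed P q1.
have [L0 _] := Lfun_submod_closed P q1.
have := H b Y _ LY (H a X _ LX L0).
by rewrite (_ : _ + _ = fun w => a * X w + b * Y w)//; apply/funext => w;
  rewrite !fctE addr0 addrC.
Qed.

Lemma probE : P [set: T] = 1%E. Proof. exact: probability_setT. Qed.

(** The $L^\infty$ norm is defined as an essential supremum guarded by a test that the total mass is
    positive; a probability passes the test. *)
Lemma LnormooE (f : T -> \bar R) :
  ('N[P]_+oo [f] = ess_sup P (abse \o f))%E.
Proof. by rewrite unlock [X in (0 < X)%E]probE lte01. Qed.

Lemma Lp_cst q (c : R) : (1 <= q)%E -> Lp P q (fun=> c).
Proof.
case: q => [p|_|//]; first by move=> _; apply/LpE/Lfun_cst.
split; first exact: measurable_cst.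
rewrite /finite_norm LnormooE.
rewrite (@ess_sup_ae_cst _ _ _ P _ `|c|%:E) ?ltry//; last exact: nearW.
by rewrite [X in (0 < X)%E]probE.
Qed.

Lemma LpooP X : Lp P +oo%E X <->
  measurable_fun setT X /\ exists M : R, {ae P, forall w, `|X w| <= M}.
Proof.
split=> -[mX].
  rewrite /finite_norm LnormooE => h; split=> //.
  exact: (ess_supr_bounded h).
move=> [M XM]; split => //=; rewrite /finite_norm LnormooE.
by apply: (@le_lt_trans _ _ M%:E); rewrite ?ltry//; apply/ess_supP.
Qed.

Lemma LpSoo p X : 1 <= p -> Lp P +oo%E X -> Lp P p%:E X.
Proof.
move=> p1 /LpE h; apply/LpE; move: X h; change {subset Lfun P +oo%E <= Lfun P p%:E}; apply: Lfun_subset; rewrite ?leey//.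
exact: fin_num_measure.
Qed.

Lemma Ldistoo_le X Y (e : R) : {ae P, forall w, `|X w - Y w| <= e} ->
  (Ldist P +oo%E X Y <= e%:E)%E.
Proof.
by move=> h; rewrite /Ldist LnormooE; apply/ess_supP.
Qed.

Lemma Ldistoo_lt X Y (e : R) : (Ldist P +oo%E X Y < e%:E)%E ->
  {ae P, forall w, `|X w - Y w| <= e}.
Proof.
by move=> /ltW; rewrite /Ldist LnormooE => /ess_supP.
Qed.

(** * Truncation of functions *)

Definition trunc (n : nat) X : T -> R :=
  fun w => Num.max (- n%:R) (Num.min n%:R (X w)).

Lemma trunc_ge0 n X w : 0 <= X w -> 0 <= trunc n X w.
Proof. by move=> Xw; rewrite /trunc le_max le_min Xw ler0n orbT. Qed.

Lemma trunc_bound n X w : `|trunc n X w| <= n%:R.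
Proof.
have n0 : (0 : R) <= n%:R by [].
by rewrite /trunc ler_norml le_max lexx/= ge_max ge_min lexx/= andbT; lra.
Qed.

Lemma measurable_trunc n X : measurable_fun setT X -> measurable_fun setT (trunc n X).
Proof. by move=> mX; apply: measurable_maxr => //; apply: measurable_minr. Qed.

Lemma trunc_ae X : Lp P +oo%E X -> exists n, {ae P, forall w, trunc n X w = X w}.
Proof.
move=> /LpooP[mX [M XM]]; have [n _ /(_ n (leqnn n)) /= hn] := nbhs_infty_ger M.
exists n; apply: filterS XM => w /le_trans - /(_ _ hn).
rewrite ler_norml => /andP[Xn nX].
by rewrite /trunc min_r// max_r.
Qed.

(** * Norm estimates for a real exponent *)

Section real_exponent.
Variable p : R.
Hypothesis p1 : 1 <= p.
Let p0 : 0 < p. Proof. exact: lt_le_trans p1. Qed.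
Let pe1 : (1 <= p%:E)%E. Proof. by rewrite lee_fin. Qed.
Local Notation N X := ('N[P]_(p%:E) [EFin \o X])%E.

Lemma Lnorm_pow X : ((N X) `^ p = \int[P]_w ((`|X w| `^ p)%:E))%E.
Proof. by rewrite powR_Lnorm// gt_eqF. Qed.

Lemma LnormD X Y : measurable_fun setT X -> measurable_fun setT Y ->
  (N (fun w => (X w + Y w)%R) <= N X + N Y)%E.
Proof. by move=> mX mY; exact: minkowski_EFin. Qed.

Lemma LnormZ_Lp X (c : R) : Lp P p%:E X ->
  (N (fun w => (c * X w)%R) = `|c|%:E * N X)%E.
Proof.
by move=> /LpE LX; have := @LnormZ _ _ _ P p%:E pe1 (Lfun_Sub pe1 LX) c.
Qed.

Lemma ae_le_Lnorm X Y : measurable_fun setT X -> measurable_fun setT Y ->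
  {ae P, forall w, `|X w| <= `|Y w|} -> (N X <= N Y)%E.
Proof.
move=> mX mY XY; rewrite unlock.
have mp Z : measurable_fun setT Z ->
    measurable_fun setT (fun w => (`|Z w| `^ p)%:E).
  move=> mZ; apply/measurable_EFinP.
  apply: (@measurableT_comp _ _ _ _ _ _ (@powR R ^~ p)) => //.
  exact: measurableT_comp.
have in0y Z : ((\int[P]_w (`|Z w| `^ p)%:E)%E \in `[0%E, +oo%E]).
  by rewrite in_itv/= leey andbT; apply: integral_ge0 => w _; rewrite lee_fin powR_ge0.
apply: gt0_ler_poweR; rewrite ?invr_ge0 ?(ltW p0)//; [exact: in0y|exact: in0y|].
apply: ae_ge0_le_integral => //.
- by move=> w _; rewrite poweR_ge0.
- exact: mp.
- by move=> w _; rewrite poweR_ge0.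
- exact: mp.
apply: filterS XY => w XYw _; rewrite /= lee_fin; apply: ge0_ler_powR; rewrite ?nnegrE//; exact: ltW.
Qed.

Lemma Lnorm_cst (c : R) : N (fun=> c) = `|c|%:E.
Proof.
rewrite unlock /= integral_cst//= probability_setT mule1 poweR_EFin -powRrM.
by rewrite mulfV ?gt_eqF// powRr1.
Qed.

Lemma Ldist_sym X Y : Ldist P p%:E X Y = Ldist P p%:E Y X.
Proof.
rewrite /Ldist -oppe_Lnorm; congr (Lnorm _ _ _); apply/funext => w /=.
by rewrite opprB.
Qed.

Lemma Ldist_triangle X Y Z : measurable_fun setT X -> measurable_fun setT Y ->
  measurable_fun setT Z ->
  (Ldist P p%:E X Z <= Ldist P p%:E X Y + Ldist P p%:E Y Z)%E.
Proof.
move=> mX mY mZ; rewrite /Ldist.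
apply: le_trans (LnormD _ _); last 2 first.
- exact: measurable_funB.
- exact: measurable_funB.
rewrite le_eqVlt; apply/orP; left; apply/eqP; apply: eq_Lnorm => w /=.
by rewrite addrA subrK.
Qed.

Lemma Ldist_le_oo X Y (e : R) : measurable_fun setT X -> measurable_fun setT Y ->
  {ae P, forall w, `|X w - Y w| <= e} -> (Ldist P p%:E X Y <= `|e|%:E)%E.
Proof.
move=> mX mY XY; rewrite -Lnorm_cst; apply: ae_le_Lnorm => //.
  exact: measurable_funB.
by apply: filterS XY => w /le_trans; apply; exact: ler_norm.
Qed.

(** Hölder's inequality against the constant $1$, with conjugate exponent $(1-1/p)^{-1}$; for $p=1$
    both sides agree. *)
Lemma integral_le_Lnorm X : measurable_fun setT X ->
  (\int[P]_w `|X w|%:E <= N X)%E.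
Proof.
move=> mX; have [->|p_neq1] := eqVneq p 1; first by rewrite Lnorm1.
have p_gt1 : 1 < p by rewrite lt_neqAle eq_sym p_neq1.
have := @hoelder _ _ _ P X (cst 1) p (1 - p^-1)^-1 mX (measurable_cst _) p0.
rewrite Lnorm_cst1 [X in (X `^ _)%E]probE poweR1r mule1 Lnorm1.
rewrite invr_gt0 subr_gt0 invf_lt1// invrK subrKC => /(_ p_gt1 erefl).
by under eq_integral do rewrite /= mulr1.
Qed.


Lemma measurable_powR_norm X : measurable_fun setT X ->
  measurable_fun setT (fun w => (`|X w| `^ p)%:E).
Proof.
move=> mX; apply/measurable_EFinP.
apply: (@measurableT_comp _ _ _ _ _ _ (@powR R ^~ p)) => //.
exact: measurableT_comp.
Qed.

Lemma Lnorm_lt X (e : R) : 0 < e ->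
  (\int[P]_w ((`|X w| `^ p)%:E) < (e `^ p)%:E)%E -> (N X < e%:E)%E.
Proof.
move=> e0; rewrite -Lnorm_pow; apply: contraTT; rewrite -!leNgt => h.
rewrite -poweR_EFin; apply: gt0_ler_poweR => //; first exact: ltW.
- by rewrite in_itv/= leey andbT lee_fin ltW.
- by rewrite in_itv/= leey andbT Lnorm_ge0.
Qed.

(** Dominated convergence for $|X-\mathrm{trunc}_n X|^p$: at each point it is eventually $0$, and
    $|X|^p$ dominates it because truncation moves a value towards $0$ without crossing it. *)
Lemma Lp_trunc_approx X (e : R) : Lp P p%:E X -> 0 < e ->
  exists n, Lp P +oo%E (trunc n X) /\ (Ldist P p%:E X (trunc n X) < e%:E)%E.
Proof.
move=> LX e0.
have mX : measurable_fun setT X by case: LX.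
have mtr n : measurable_fun setT (trunc n X) by exact: measurable_trunc.
pose f_ n w : \bar R := (`|X w - trunc n X w| `^ p)%:E.
have mf n : measurable_fun setT (f_ n).
  by apply: measurable_powR_norm; exact: measurable_funB.
have iX : P.-integrable setT (fun w => (`|X w| `^ p)%:E).
  by apply: Lfun_integrable => //; apply/LpE.
have cvf w : f_ ^~ w @ \oo --> (0 : \bar R)%E.
  apply/cvg_ballP => eps eps0; near=> n.
  rewrite /f_ /trunc (_ : X w - _ = 0) ?normr0 ?powR0 ?gt_eqF//.
    exact: ballxx.
  have : `|X w| <= n%:R by near: n; exact: nbhs_infty_ger.
  by rewrite ler_norml => /andP[a b]; rewrite min_r// max_r// subrr.
have dom n w : (`|f_ n w| <= (`|X w| `^ p)%:E)%E.
  rewrite gee0_abs ?lee_fin ?powR_ge0// ge0_ler_powR ?nnegrE ?(ltW p0)//.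
  have n0 : (0 : R) <= n%:R by [].
  rewrite /trunc /Num.max /Num.min.
  by case: ifPn; case: ifPn; rewrite ?ltNge ?negbK => h1 h2;
    case: (lerP 0 (X w)) => h3; (rewrite ?ler_norml; case: ler0P => *; lra).
have [_ _ cvint] := @dominated_convergence _ _ _ P setT measurableT f_ (cst 0%E)
  _ mf (measurable_cst _) (aeW _ (fun w _ => cvf w)) iX
  (aeW _ (fun w n _ => dom n w)).
rewrite integral0 in cvint.
have ep0 : (0 < (e `^ p)%:E)%E by rewrite lte_fin powR_gt0.
have [n _ /(_ n (leqnn n)) hn] : \forall n \near \oo,
    (\int[P]_w (f_ n w) < (e `^ p)%:E)%E.
  rewrite lte_fin in ep0.
  exact: (cvint _ (@nbhs_open_ereal_lt _ _ (fun=> e `^ p) ep0)).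
exists n; split; last exact: Lnorm_lt.
apply/LpooP; split=> //; exists n%:R; apply: aeW => w; exact: trunc_bound.
Unshelve. all: by end_near. Qed.

(* The majorant is (sum_n |V_n|^p)^(1/p). *)
Lemma Lp_majorant (V : nat -> T -> R) : (forall n, Lp P p%:E (V n)) ->
  (forall n, (N (V n) <= (2 ^- n.+1)%:E)%E) ->
  exists Z, Lp P p%:E Z /\ forall n, {ae P, forall w, `|V n w| <= Z w}.
Proof.
move=> LV NV.
pose S w := (\sum_(n <oo) (`|V n w| `^ p)%:E)%E.
have mV n : measurable_fun setT (V n) by case: (LV n).
have S0 w : (0 <= S w)%E by apply: nneseries_ge0 => n _ _; rewrite lee_fin powR_ge0.
have mS : measurable_fun setT S.
  apply: ge0_emeasurable_sum => [n w _ _|n _]; first by rewrite lee_fin powR_ge0.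
  exact: measurable_powR_norm.
(* The norms are at most $1$, so their $p$-th powers are no larger than the norms themselves, and
   the bounds $2^{-(n+1)}$ sum to $1$. *)
have intS : (\int[P]_w S w <= 1%:E)%E.
  rewrite integral_nneseries//; last first.
    by move=> n; exact: measurable_powR_norm.
  apply: le_trans (@epsilon_trick0 R 1 xpredT ler01).
  apply: lee_nneseries => n _; first by move=> _; apply: integral_ge0 => w _; rewrite lee_fin powR_ge0.
  rewrite -Lnorm_pow div1r natrX.
  have := NV n; have := Lnorm_ge0 P p%:E (EFin \o V n).
  case: (N (V n)) => [r| |]//; rewrite poweR_EFin !lee_fin => r0 rn.
  have r1 : r <= 1 by rewrite (le_trans rn)// invf_le1 ?exprn_ege1 ?exprn_gt0// ler1n.
  have [->|r_neq0] := eqVneq r 0; first by rewrite powR0 ?gt_eqF// invr_ge0 exprn_ge0.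
  apply: le_trans rn; rewrite -[leRHS]powRr1//.
  by apply: ger_powR => //; rewrite lt0r r_neq0 r0.
have iS : P.-integrable setT S.
  apply/integrableP; split=> //.
  by under eq_integral do rewrite gee0_abs//; rewrite (le_lt_trans intS) ?ltry.
exists (fun w => fine (S w) `^ p^-1); split.
  have mZ : measurable_fun setT (fun w => fine (S w) `^ p^-1).
    apply: (@measurableT_comp _ _ _ _ _ _ (@powR R ^~ p^-1)) => //.
    exact: measurableT_comp.
  split=> //; rewrite /finite_norm.
  (* [Lnorm_lt] asks for a strict bound, supplied by $1 < 2^p$. *)
  apply: (@le_lt_trans _ _ 2%:E); rewrite ?ltry// ltW// Lnorm_lt//.
  apply: (@le_lt_trans _ _ 1%:E).
    apply: le_trans intS; apply: ge0_le_integral => //.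
    - exact: measurable_powR_norm.
    - move=> w _; rewrite ger0_norm ?powR_ge0// -powRrM mulVf ?gt_eqF//.
      rewrite powRr1 ?fine_ge0//.
      by case: (S w) (S0 w) => // *; rewrite leey.
  have := @gt0_ltr_powR R p p0 1 2; rewrite !nnegrE powR1 lte_fin.
  by apply; rewrite ?ltr1n.
(* [fine] sends an infinite value of [S] to $0$, so the bound is sought only where [S] is finite,
   which is almost everywhere. *)
move=> n; have := integrable_ae measurableT iS.
apply: filterS => w /(_ I) Sfin.
have -> : `|V n w| = (`|V n w| `^ p) `^ p^-1.
  by rewrite -powRrM mulfV ?gt_eqF// powRr1.
rewrite ge0_ler_powR ?invr_ge0 ?(ltW p0) ?nnegrE ?powR_ge0 ?fine_ge0//.
rewrite -lee_fin fineK//.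
apply: le_trans (@nneseries_lim_ge _ _ xpredT 0%N n.+1 _); last first.
  by move=> k _ _; rewrite lee_fin powR_ge0.
rewrite big_nat_recr//= leeDr// sume_ge0//.
Qed.

End real_exponent.
End LpSpaces.

(** * Averaging on a nonatomic space *)

Section Nonatomic.
Context {d : measure_display} {T : measurableType d} {R : realType}.
Variable P : probability T R.
Import numFieldNormedType.Exports.
Implicit Types (A B C E F : set T) (X Y : T -> R) (t : R).

(** Real-valued, so that linear arithmetic applies to masses of sets. *)
Definition prob A : R := fine (P A).

Lemma probP A : measurable A -> P A = (prob A)%:E.
Proof. by move=> mA; rewrite /prob fineK// fin_num_measure. Qed.

Lemma prob_ge0 A : 0 <= prob A.
Proof. by rewrite fine_ge0. Qed.

Lemma prob_set0 : prob set0 = 0.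
Proof. by rewrite /prob measure0. Qed.

Lemma prob_le A B : measurable A -> measurable B -> A `<=` B ->
  prob A <= prob B.
Proof.
by move=> mA mB AB; rewrite -lee_fin -!probP// le_measure// inE.
Qed.

Lemma prob_setU A B : measurable A -> measurable B -> A `&` B = set0 ->
  prob (A `|` B) = prob A + prob B.
Proof.
move=> mA mB AB0; apply: EFin_inj.
by rewrite EFinD -!probP//; [exact: measureU|exact: measurableU].
Qed.

Lemma prob_setD A B : measurable A -> measurable B -> A `<=` B ->
  prob (B `\` A) = prob B - prob A.
Proof.
move=> mA mB AB; have mD : measurable (B `\` A) by exact: measurableD.
rewrite -{2}(setDUK AB) prob_setU//; last first.
  by rewrite setIDA setIC -setIDA setDv setI0.
by rewrite addrC addKr.
Qed.

Lemma prob_cvg_bigcup (F : nat -> set T) : (forall n, measurable (F n)) ->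
  nondecreasing_seq F ->
  (fun n => prob (F n)) @ \oo --> prob (\bigcup_n F n).
Proof.
move=> mF ndF; have mU : measurable (\bigcup_n F n) by exact: bigcupT_measurable.
have := nondecreasing_cvg_mu (mu := P) mF mU ndF.
by rewrite [X in _ --> X -> _](probP mU) => /fine_cvg.
Qed.

Lemma prob_cvg_bigcap (F : nat -> set T) : (forall n, measurable (F n)) ->
  nonincreasing_seq F ->
  (fun n => prob (F n)) @ \oo --> prob (\bigcap_n F n).
Proof.
move=> mF niF; have mU : measurable (\bigcap_n F n) by exact: bigcapT_measurable.
have F0oo : (P (F 0%N) < +oo)%E by rewrite probP// ltry.
have := nonincreasing_cvg_mu (mu := P) F0oo mF mU niF.
by rewrite [X in _ --> X -> _](probP mU) => /fine_cvg.
Qed.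

(** * Sets of prescribed mass and quantile partitions *)

Hypothesis Pna : nonatomic P.

(** Of a proper piece and its complement in [A], one has at most half the mass. *)
Lemma nonatomic_half A : measurable A -> 0 < prob A ->
  exists B, [/\ measurable B, B `<=` A, 0 < prob B & prob B <= prob A / 2].
Proof.
move=> mA A0; have [|B [mB BA]] := Pna mA; first by rewrite probP// lte_fin.
rewrite !probP// !lte_fin => B0 BltA.
have [BA2|BA2] := leP (prob B) (prob A / 2); first by exists B.
exists (A `\` B); split; [exact: measurableD|by move=> x []| |];
  rewrite prob_setD//; lra.
Qed.

Lemma nonatomic_small A (e : R) : measurable A -> 0 < prob A -> 0 < e ->
  exists B, [/\ measurable B, B `<=` A, 0 < prob B & prob B < e].
Proof.
move=> mA A0 e0.
have H n : exists B, [/\ measurable B, B `<=` A, 0 < prob B &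
    prob B <= prob A / 2 ^+ n].
  elim: n => [|n [B [mB BA B0 Bn]]]; first by exists A; rewrite expr0 divr1; split.
  have [C [mC CB C0 Cn]] := nonatomic_half mB B0.
  exists C; split=> //; first exact: subset_trans BA.
  apply: (le_trans Cn); rewrite exprSr invfM mulrA.
  by rewrite ler_wpM2r.
have [n An] : exists n : nat, prob A / e < 2 ^+ n.
  have := @nbhs_infty_gtr R (prob A / e) => -[n _ /(_ n (leqnn n)) /= hn].
  exists n; apply: (lt_trans hn); rewrite -natrX ltr_nat.
  exact: ltn_expl.
have [B [mB BA B0 Bn]] := H n; exists B; split=> //.
apply: (le_lt_trans Bn); rewrite ltr_pdivrMr ?exprn_gt0//.
by rewrite mulrC -ltr_pdivrMr.
Qed.

(* Greedy exhaustion: each step gains at least half of the possible gain, so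
   the union of the steps cannot be enlarged without exceeding [t]. *)
Lemma sierpinski E t : measurable E -> 0 <= t <= prob E ->
  exists B, [/\ measurable B, B `<=` E & prob B = t].
Proof.
move=> mE /andP[t0 tE].
pose adm B := [/\ measurable B, B `<=` E & prob B <= t].
(* The implication stands under the existential so that [choice] gives a total function; outside
   [adm] its value is arbitrary. *)
have step B : exists B', adm B -> [/\ adm B', B `<=` B' &
    forall C, adm C -> B `<=` C -> prob C - prob B <= 2 * (prob B' - prob B)].
  have [aB|naB] := pselect (adm B); last by exists B.
  pose S := [set prob C | C in [set C | adm C /\ B `<=` C]].
  have S0 : has_sup S.
    split; first by exists (prob B); exists B => //; split.
    by exists t => _ [C [[_ _ ?] _] <-].
  have BS : prob B <= sup S by apply: sup_upper_bound => //; exists B => //; split.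
  have [sB|sB] := eqVneq (sup S) (prob B).
    exists B => _; split=> // C aC BC; rewrite subrr mulr0 subr_le0 -sB.
    by apply: sup_upper_bound => //; exists C.
  have g0 : 0 < (sup S - prob B) / 2.
    by rewrite divr_gt0// subr_gt0 lt_neqAle eq_sym sB.
  have [_ [B' [aB' BB'] <-] hB'] := sup_adherent g0 S0.
  exists B' => _; split=> // C aC BC.
  have : prob C <= sup S by apply: sup_upper_bound => //; exists C.
  by move: hB'; lra.
have [f fP] := choice step.
pose B n := iter n f set0.
have aB n : adm (B n).
  elim: n => [|n IH]; last by have [] := fP _ IH.
  by split => //; [exact: measurable0|rewrite prob_set0].
have BS n : B n `<=` B n.+1 by have [] := fP _ (aB n).
have ndB : nondecreasing_seq B.
  by apply/nondecreasing_seqP => n; rewrite subsetEset.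
have mB n : measurable (B n) by case: (aB n).
have cvB := prob_cvg_bigcup mB ndB.
set U := \bigcup_n B n in cvB.
have mU : measurable U by exact: bigcupT_measurable.
have UE : U `<=` E by move=> x [n _]; case: (aB n) => _ + _; exact.
have Ut : prob U <= t.
  rewrite -(cvg_lim _ cvB)//; apply: limr_le; first by apply/cvg_ex; eexists; exact: cvB.
  by apply: nearW => n; case: (aB n).
exists U; split=> //; apply/eqP; rewrite eq_le Ut leNgt; apply/negP => Ult.
(* If mass is still missing, a non-null [C] lighter than the gap fits into the rest of [E]. *)
have [|||C [mC CD C0 Ct]] := @nonatomic_small (E `\` U) (t - prob U).
- exact: measurableD.
- by rewrite prob_setD// subr_gt0 (lt_le_trans Ult).
- by rewrite subr_gt0.
have UC : U `&` C = set0.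
  by apply/seteqP; split=> // x [Ux /CD[]].
have aUC : adm (U `|` C).
  split; [exact: measurableU|by move=> x [/UE//|/CD[]]|].
  by rewrite prob_setU//; lra.
(* $U\cup C$ competes at every step. The gains tend to $0$, so these inequalities give
   $\mathbb{P}(C)\le 0$ in the limit, a contradiction. *)
have H n : prob U + prob C - prob (B n) <= 2 * (prob (B n.+1) - prob (B n)).
  have [_ _ h] := fP _ (aB n); rewrite -prob_setU//; apply: h => //.
  by move=> x Bx; left; exists n.
have cvS : (fun n => prob (B n.+1)) @ \oo --> prob U.
  by move: cvB; rewrite -(cvg_shiftS (fun n => prob (B n))).
have c1 : (fun n => 2 * prob (B n.+1) - prob (B n)) @ \oo --> 2 * prob U - prob U.
  by apply: cvgB => //; apply: cvgMr.
have : prob U + prob C <= 2 * prob U - prob U.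
  rewrite -[leRHS](cvg_lim _ c1)//; apply: limr_ge.
    by apply/cvg_ex; eexists; exact: c1.
  by apply: nearW => n; move: (H n); lra.
lra.
Qed.

(** [c] is the lower [t]-quantile of [X] on [E], so that $\{X<c\}$ has mass at most [t] and $\{X\le
    c\}$ at least [t]. Sierpinski's theorem cuts from the level set $\{X=c\}$ exactly the mass that
    is missing. *)
Lemma quantile_split X E t (a M : R) : measurable_fun setT X -> measurable E ->
  0 <= t <= prob E -> a <= M -> (forall w, E w -> a <= X w <= M) ->
  exists F c, [/\ measurable F, F `<=` E, prob F = t, a <= c <= M &
    (forall w, F w -> X w <= c) /\ (forall w, (E `\` F) w -> c <= X w)].
Proof.
move=> mX mE /andP[t0 tE] aM XaM.
have mle q : measurable (E `&` [set w | X w <= q]).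
  apply: measurableI => //.
  rewrite (_ : [set w | _] = setT `&` X @^-1` `]-oo, q]%classic).
    by apply: mX => //; exact: measurable_itv.
  by rewrite setTI; apply/seteqP; split=> w /=; rewrite in_itv.
have mlt q : measurable (E `&` [set w | X w < q]).
  apply: measurableI => //.
  rewrite (_ : [set w | _] = setT `&` X @^-1` `]-oo, q[%classic).
    by apply: mX => //; exact: measurable_itv.
  by rewrite setTI; apply/seteqP; split=> w /=; rewrite in_itv.
pose Q := [set q | a <= q /\ t <= prob (E `&` [set w | X w <= q])].
have QM : Q M.
  split=> //; rewrite (_ : _ `&` _ = E)//; apply/seteqP; split=> [w []//|w Ew].
  by split=> //=; case/andP: (XaM _ Ew).
have Qinf : has_inf Q by split; [exists M|exists a => q []].
pose c := inf Q.
have ac : a <= c by apply: lb_le_inf; [exists M|move=> q []].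
have cM : c <= M by apply: inf_lbound => //; case: Qinf.
have up : t <= prob (E `&` [set w | X w <= c]).
  pose F n := E `&` [set w | X w <= c + n.+1%:R^-1].
  have mF n : measurable (F n) by exact: mle.
  have niF : nonincreasing_seq F.
    move=> m n mn; rewrite subsetEset => w [Ew] /= Xw; split=> //=.
    by apply: (le_trans Xw); rewrite lerD2l lef_pV2 ?posrE ?ler_nat.
  have := prob_cvg_bigcap mF niF.
  rewrite (_ : \bigcap_n F n = E `&` [set w | X w <= c]); last first.
    apply/seteqP; split=> w; last first.
      by move=> [Ew] /= Xw n _; split=> //=; rewrite (le_trans Xw)// lerDl.
    move=> Fw; split=> /=; first by case: (Fw 0%N I).
    apply/ler_addgt0Pl => e e0; rewrite addrC.
    have := @nbhs_infty_gtr R e^-1 => -[n _ /(_ n (leqnn n)) /= hn].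
    have [_ /= Xw] := Fw n I; rewrite (le_trans Xw)// lerD2l.
    rewrite -[leRHS]invrK lef_pV2 ?posrE ?invr_gt0//.
    by rewrite (le_trans (ltW hn))// ler_nat.
  move=> cv; rewrite -(cvg_lim _ cv)//; apply: limr_ge.
    by apply/cvg_ex; eexists; exact: cv.
  apply: nearW => n; have n0 : 0 < n.+1%:R^-1 :> R by rewrite invr_gt0.
  have [q [aq tq] qc] := inf_adherent n0 Qinf.
  apply: (le_trans tq); apply: prob_le => // w [Ew] /= Xw; split=> //=.
  by rewrite (le_trans Xw)// ltW.
have down : prob (E `&` [set w | X w < c]) <= t.
  pose F n := E `&` [set w | X w <= c - n.+1%:R^-1].
  have mF n : measurable (F n) by exact: mle.
  have ndF : nondecreasing_seq F.
    move=> m n mn; rewrite subsetEset => w [Ew] /= Xw; split=> //=.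
    by apply: (le_trans Xw); rewrite lerD2l lerN2 lef_pV2 ?posrE ?ler_nat.
  have := prob_cvg_bigcup mF ndF.
  rewrite (_ : \bigcup_n F n = E `&` [set w | X w < c]); last first.
    apply/seteqP; split=> w.
      move=> [n _ [Ew] /= Xw]; split=> //=; rewrite (le_lt_trans Xw)//.
      by rewrite gtrBl.
    move=> [Ew] /= Xw.
    have := @nbhs_infty_gtr R (c - X w)^-1 => -[n _ /(_ n (leqnn n)) /= hn].
    exists n => //; split=> //=; rewrite lerBrDl -lerBrDr.
    have cX0 : 0 < c - X w by rewrite subr_gt0.
    rewrite -[leRHS]invrK lef_pV2 ?posrE ?invr_gt0//.
    by rewrite (le_trans (ltW hn))// ler_nat.
  move=> cv; rewrite -(cvg_lim _ cv)//; apply: limr_le.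
    by apply/cvg_ex; eexists; exact: cv.
  apply: nearW => n; have n0 : 0 < n.+1%:R^-1 :> R by rewrite invr_gt0.
  (* Below [a] the sublevel set is empty; otherwise a mass above [t] would put $c-1/(n+1)$ into [Q],
     beneath its infimum. *)
  have [an|an] := leP a (c - n.+1%:R^-1); last first.
    rewrite (_ : F n = set0) ?prob_set0//; apply/seteqP; split=> // w [Ew] /= Xw.
    have /andP[aX _] := XaM _ Ew.
    by have := le_lt_trans (le_trans aX Xw) an; rewrite ltxx.
  have [//|tF] := leP (prob (F n)) t.
  have : c <= c - n.+1%:R^-1.
    by apply: inf_lbound; [case: Qinf|split=> //; exact: ltW].
  by rewrite lerDl oppr_ge0 leNgt n0.
set L := E `&` [set w | X w < c] in down.
set U := E `&` [set w | X w <= c] in up.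
have LU : L `<=` U by move=> w [Ew] /= /ltW.
have mL : measurable L by exact: mlt.
have mU : measurable U by exact: mle.
have [||H [mH HG Ht]] := @sierpinski (U `\` L) (t - prob L).
- exact: measurableD.
- by rewrite prob_setD//; lra.
have LH : L `&` H = set0 by apply/seteqP; split=> // w [Lw /HG[]].
exists (L `|` H), c; split.
- exact: measurableU.
- by move=> w [[]//|/HG[[]]].
- by rewrite prob_setU// Ht; lra.
- by rewrite ac.
split=> [w [[_] /ltW//|/HG[[_]]//]|w [Ew /not_orP[nL _]]].
by rewrite leNgt; apply/negP => Xw; apply: nL.
Qed.

Lemma bounded_integrable X E (a M : R) : measurable_fun setT X ->
  measurable E -> (forall w, E w -> a <= X w <= M) ->
  P.-integrable E (EFin \o X).
Proof.
move=> mX mE XaM; apply: measurable_bounded_integrable => //.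
- by have : (P E < +oo)%E by rewrite probP// ltry.
- exact: measurable_funTS.
exists (`|a| + `|M|); split; first exact: num_real.
move=> x hx w Ew; have /andP[h1 h2] := XaM _ Ew.
apply: le_trans (ltW hx); rewrite ler_norml.
have := ler_norm M; have := ler_norm (- a); rewrite normrN => h3 h4.
have := normr_ge0 M; have := normr_ge0 a => h5 h6.
by apply/andP; split; lra.
Qed.

(* Peeling off the lowest [h]-quantile leaves a remainder on which [X] is at
   least the split point, so the errors [h * (upper - lower)] telescope. *)
Lemma quantile_partition X (M h : R) (N : nat) E (a : R) :
  measurable_fun setT X -> 0 <= h -> measurable E -> prob E = h * N.+1%:R ->
  a <= M -> (forall w, E w -> a <= X w <= M) ->
  exists (l : T -> nat) (c : nat -> R),
    [/\ measurable_fun setT l,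
       forall w, E w -> (l w <= N)%N /\ X w <= c (l w),
       forall i, (i <= N)%N -> prob (E `&` l @^-1` [set i]) = h,
       forall i, a <= c i <= M &
       \sum_(i < N.+1) h * c i <= \int[P]_(w in E) X w + h * (M - a)].
Proof.
move=> mX h0; elim: N E a => [|N IH] E a mE PE aM XaM.
  exists (fun=> 0%N), (fun=> M); split=> //.
  - by move=> w Ew; split=> //; case/andP: (XaM _ Ew).
  - move=> i; rewrite leqn0 => /eqP ->.
    by rewrite (_ : _ `&` _ = E) ?PE ?mulr1//; apply/seteqP; split=> // w [].
  - by move=> _; rewrite aM lexx.
  rewrite big_ord1 mulrBr.
  have : \int[P]_(w in E) a <= \int[P]_(w in E) X w.
    apply: le_Rintegral => //; first 1 last.
    - exact: bounded_integrable XaM.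
    - by move=> w /XaM /andP[].
    - by apply: (@bounded_integrable (cst a) _ a a) => // w _; rewrite /= lexx.
  rewrite Rintegral_cst// -[X in a * X]/(prob E) PE mulr1; lra.
have [|F [c0 [mF FE PF /andP[ac cM] [XF XEF]]]] :=
    @quantile_split X E h a M mX mE _ aM XaM.
  by rewrite h0/= PE -[leLHS]mulr1 ler_wpM2l// ler1n.
have mD : measurable (E `\` F) by exact: measurableD.
have PD : prob (E `\` F) = h * N.+1%:R.
  by rewrite prob_setD// PE PF -(natr1 N.+1) mulrDr mulr1 addrK.
have XcM w : (E `\` F) w -> c0 <= X w <= M.
  by move=> EFw; rewrite XEF//=; case: EFw => /XaM /andP[].
have [l [c [ml lX Pl cb sumc]]] := IH _ _ mD PD cM XcM.
exists (fun w => if w \in F then 0%N else (l w).+1), (fun i => if i is j.+1 then c j else c0).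
split.
- apply: measurable_fun_ifT => //; last exact: measurableT_comp.
  apply: (measurable_fun_bool true); rewrite setTI.
  by rewrite (_ : _ @^-1` _ = F)//; apply/seteqP; split=> w /=; [move/set_mem|exact: mem_set].
- move=> w Ew; case: ifPn => [/set_mem Fw|/negP nF]; first by split=> //; exact: XF.
  by apply: lX; split=> // Fw; apply: nF; rewrite inE.
- case=> [_|i iN].
    rewrite (_ : _ `&` _ = F) ?PF//; apply/seteqP; split=> w /=.
      by move=> [_]; case: ifPn => // /set_mem.
    by move=> Fw; split; [exact: FE|rewrite mem_set].
  rewrite -(Pl i)//; congr prob; apply/seteqP; split=> w /=.
    move=> [Ew]; case: ifPn => // /negP nF [<-]; split=> //; split=> // Fw.
    by apply: nF; rewrite inE.
  by move=> [[Ew nF] <-]; split=> //; rewrite memNset.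
- case=> [|i]; first by rewrite ac.
  by have /andP[ci ->] := cb i; rewrite (le_trans ac).
rewrite big_ord_recl /=.
have -> : \int[P]_(w in E) X w = \int[P]_(w in F) X w + \int[P]_(w in E `\` F) X w.
  rewrite -Rintegral_setU// ?setDUK//; first exact: bounded_integrable XaM.
  by apply/disj_setPS => w [Fw []].
(* The integral over [F] is at least [h * a]. Together with the new term [h * c0] and the
   remainder's error [h * (M - c0)], the total error is [h * (M - a)]. *)
have : \int[P]_(w in F) a <= \int[P]_(w in F) X w.
  apply: le_Rintegral => //; first 1 last.
  - by apply: (@bounded_integrable _ _ a M) => // w /FE /XaM.
  - by move=> w /FE /XaM /andP[].
  - by apply: (@bounded_integrable (cst a) _ a a) => // w _; rewrite /= lexx.
rewrite Rintegral_cst// -[X in a * X]/(prob F) PF.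
move: (sumc : \sum_(i < N.+1) h * c (0 + i)%N <= _); lra.
Qed.

(** The labelled pieces are disjoint and of equal mass, so the mass selected by [J] depends only on
    the number of labels in [J]. This is why permuting the values of a step function preserves its
    law. *)
Lemma prob_label E (l : T -> nat) (N : nat) (h : R) (J : pred 'I_N.+1) :
  measurable E -> measurable_fun setT l ->
  (forall w, E w -> (l w <= N)%N) ->
  (forall i, (i <= N)%N -> prob (E `&` l @^-1` [set i]) = h) ->
  measurable (E `&` [set w | J (inord (l w))]) /\
  prob (E `&` [set w | J (inord (l w))]) = \sum_(i | J i) h.
Proof.
move=> mE ml lN Pl.
have mEl i : measurable (E `&` l @^-1` [set i]).
  by apply: measurableI => //; rewrite -[_ @^-1` _]setTI; exact: ml.
rewrite (_ : _ `&` _ = \big[setU/set0]_(i | J i) (E `&` l @^-1` [set nat_of_ord i])).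
  split; first by apply: bigsetU_measurable.
  apply: EFin_inj; rewrite -probP; last exact: bigsetU_measurable.
  apply: etrans (measure_bigsetU_ord _ _ _ _) _ => //.
    apply/trivIsetP => i j _ _ ij; apply/seteqP; split=> // w [] [_ /= lwi] [_ /= lwj].
    by move/eqP: ij; apply; apply: val_inj; rewrite /= -lwi -lwj.
  by rewrite -sumEFin; apply: eq_bigr => i _; rewrite [LHS](probP (mEl i)) Pl// -ltnS.
apply/seteqP; split=> w.
  move=> [Ew] /= Jw; rewrite -bigcup_seq_cond; exists (inord (l w)); first by rewrite /= mem_index_enum.
  by split=> //=; rewrite inordK// ltnS lN.
rewrite -bigcup_seq_cond => -[i /= /andP[_ Ji] [Ew /= lwi]]; split=> //=.
by rewrite lwi inord_val.
Qed.

(** Induction: the average of $n+2$ terms is the previous average with weight $(n+1)/(n+2)$ plus the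
    new term with the remaining weight. *)
Lemma convex_average (A : set (T -> R)) (Y : nat -> T -> R) (n : nat) :
  convex_set A -> (forall i, A (Y i)) ->
  A (fun w => (\sum_(i < n.+1) Y i w) / n.+1%:R).
Proof.
move=> cA AY; elim: n => [|n IH].
  by rewrite (_ : (fun _ => _) = Y 0%N)//; apply/funext => w; rewrite big_ord1 divr1.
have n0 : n.+1%:R != 0 :> R by rewrite pnatr_eq0.
have n20 : n.+2%:R != 0 :> R by rewrite pnatr_eq0.
have lE : 1 - n.+1%:R / n.+2%:R = n.+2%:R^-1 :> R.
  by rewrite -[X in X - _](mulfV n20) -mulrBl -natrB// subSnn mul1r.
have := cA _ _ (n.+1%:R / n.+2%:R) IH (AY n.+1).
rewrite lE divr_ge0//= ler_pdivrMr ?ltr0n// mul1r ler_nat leqnSn => /(_ erefl).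
congr A; apply/funext => w; rewrite [in RHS]big_ord_recr/= mulrDl; congr (_ + _).
  by rewrite mulrC -mulrA mulKf.
by rewrite mulrC.
Qed.

(** * Stability of the acceptance set under conditional means *)

Section averaging.
Variable A : set (T -> R).
Hypotheses (accA : acceptance_set P +oo%E A) (cA : convex_set A)
  (lawA : law_invariant P +oo%E A).

(* The step function dominating [X] on [E] has the same law as its cyclic
   shifts over the equiprobable pieces, and these average to a constant. *)
Lemma average_on_set X E (K e : R) : A X -> (forall w, `|X w| <= K) ->
  measurable E -> 0 < prob E -> 0 < e ->
  exists Z (m : R), [/\ A Z, (forall w, E w -> Z w = m),
    (forall w, ~ E w -> Z w = X w) &
    m <= (\int[P]_(w in E) X w) / prob E + e].
Proof.
move=> AX XK mE E0 e0.
have [AL _ _ monA] := accA.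
have mX : measurable_fun setT X by case: (AL _ AX).
have [w0 _] : exists w, E w.
  by apply/set0P/eqP => E_eq0; move: E0; rewrite E_eq0 prob_set0 ltxx.
have K0 : 0 <= K by exact: le_trans (XK w0).
(* Enough pieces for the partition error $2Kh = 2K\,\mathbb{P}(E)/(N+1)$ to stay below
   $e\,\mathbb{P}(E)$. *)
have [N hN] : exists N : nat, 2 * K / e < N.+1%:R.
  have := @nbhs_infty_gtr R (2 * K / e) => -[n _ /(_ n.+1 (leqnSn n)) /= hn].
  by exists n.
pose h := prob E / N.+1%:R.
have h0 : 0 <= h by rewrite divr_ge0// ltW.
have XKE w : E w -> - K <= X w <= K by move=> _; rewrite -ler_norml.
have PE : prob E = h * N.+1%:R by rewrite mulfVK// pnatr_eq0.
have [|l [c [ml lX Pl cb sumc]]] :=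
  @quantile_partition X K h N E (- K) mX h0 mE PE _ XKE; first by lra.
have lN w (Ew : E w) : (l w <= N)%N by case: (lX w Ew).
(* Addition in ['I_N.+1] is modulo $N+1$, so [Y k] is the step function with its values shifted
   cyclically by [k]. [Y 0] dominates [X]. *)
pose Y (k : nat) w := if w \in E then c (inord (l w) + inord k : 'I_N.+1)%R else X w.
have preY k (B : set R) : Y k @^-1` B = (X @^-1` B `\` E) `|`
    (E `&` [set w | (fun i : 'I_N.+1 => c (i + inord k)%R \in B) (inord (l w))]).
  apply/seteqP; split=> w /=; rewrite /Y.
    case: ifPn => [/set_mem Ew Bw|/negP nE Bw]; first by right; split=> //; exact: mem_set.
    by left; split=> // Ew; apply: nE; exact: mem_set.
  by case=> [[Bw nE]|[Ew /set_mem Bw]]; [rewrite memNset|rewrite mem_set].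
have mXB (B : set R) : measurable B -> measurable (X @^-1` B `\` E).
  by move=> mB; apply: measurableD => //; rewrite -[_ @^-1` _]setTI; exact: mX.
have mY k : measurable_fun setT (Y k).
  move=> _ B mB; rewrite setTI preY; apply: measurableU; first exact: mXB.
  by have [] := prob_label (fun i : 'I_N.+1 => c (i + inord k)%R \in B) mE ml lN Pl.
have LY k : Lp P +oo%E (Y k).
  apply/LpooP; split=> //; exists K; apply: aeW => w; rewrite /Y.
  by case: ifPn => // _; rewrite ler_norml cb.
have probY k (B : set R) : measurable B -> prob (Y k @^-1` B) =
    prob (X @^-1` B `\` E) + \sum_(i : 'I_N.+1 | c i \in B) h.
  move=> mB; rewrite preY.
  have [mJ PJ] := prob_label (fun i : 'I_N.+1 => c (i + inord k)%R \in B) mE ml lN Pl.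
  rewrite prob_setU ?PJ//; [|exact: mXB|]; last first.
    by apply/seteqP; split=> // w [[_ nE] [/nE]].
  congr (_ + _); rewrite [RHS](reindex_inj (addIr (inord k : 'I_N.+1))) /=.
  by [].
have AY0 : A (Y 0%N).
  apply: monA AX _ _; first exact: LY.
  apply: aeW => w; rewrite /Y; case: ifPn => // /set_mem Ew.
  rewrite (_ : inord 0 = 0)%R ?addr0; last by apply: val_inj; rewrite /= inordK.
  by rewrite inordK ?ltnS ?lN//; case: (lX w Ew).
have AY k : A (Y k).
  apply: lawA AY0 _; first exact: LY.
  move=> B mB.
  have mYB j : measurable (Y j @^-1` B) by rewrite -[_ @^-1` _]setTI; exact: mY.
  by rewrite !probP// !probY.
exists (fun w => (\sum_(i < N.+1) Y i w) / N.+1%:R), ((\sum_(i < N.+1) c i) / N.+1%:R).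
split; first exact: convex_average.
- move=> w Ew; congr (_ / _); rewrite [RHS](reindex_inj (addrI (inord (l w) : 'I_N.+1))) /=.
  by apply: eq_bigr => i _; rewrite /Y mem_set// inord_val.
- move=> w nE; rewrite (eq_bigr (fun=> X w)); last first.
    by move=> i _; rewrite /Y memNset.
  by rewrite sumr_const card_ord -[X w *+ _]mulr_natr mulfK// pnatr_eq0.
have -> : (\sum_(i < N.+1) c i) / N.+1%:R = (\sum_(i < N.+1) h * c i) / prob E.
  rewrite -mulr_sumr /h [X in _ = X / _]mulrC -mulrA; congr (_ * _).
  by rewrite [RHS]mulrC mulKf ?gt_eqF.
rewrite ler_pdivrMr// mulrDl mulfVK ?gt_eqF//.
apply: (le_trans sumc); rewrite lerD2l opprK.
rewrite PE mulrCA ler_wpM2l//.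
by move: hN; rewrite ltr_pdivrMr//; lra.
Qed.

(** The sets are treated one after another. Disjointness leaves [X] untouched on the sets still to
    come, so the mean taken at each step is that of the original [X]; the third clause carries this
    through the induction. Null sets are skipped. *)
Lemma average_on_sets X (K e : R) (F : nat -> set T) (k : nat) :
  A X -> (forall w, `|X w| <= K) -> (forall i, measurable (F i)) ->
  trivIset setT F -> 0 < e ->
  exists Z, [/\ A Z, exists K', forall w, `|Z w| <= K',
    forall i w, (k <= i)%N -> F i w -> Z w = X w &
    forall i w, (i < k)%N -> 0 < prob (F i) -> F i w ->
      Z w <= (\int[P]_(w in F i) X w) / prob (F i) + e].
Proof.
move=> AX XK mF tF e0; elim: k => [|k [Z [AZ [K' ZK'] ZX Zle]]].
  by exists X; split=> //; exists K.
have disj i w : F i w -> F k w -> i = k.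
  by move=> Fi Fk; apply: (tF i k I I); exists w.
have [F0|F0] := ltP 0 (prob (F k)); last first.
  exists Z; split=> //; first by exists K'.
    by move=> i w ki; apply: ZX; exact: ltnW.
  move=> i w; rewrite ltnS leq_eqVlt => /predU1P[->|]; last exact: Zle.
  by rewrite ltNge F0.
have [Z' [m [AZ' Z'm Z'Z mle]]] := average_on_set AZ ZK' (mF k) F0 e0.
exists Z'; split=> //.
- exists (`|m| + K') => w; have [Fw|nFw] := pselect (F k w).
    by rewrite Z'm// lerDl (le_trans _ (ZK' w)).
  by rewrite Z'Z// (le_trans (ZK' w))// lerDr.
- move=> i w ki Fiw; rewrite Z'Z; first exact: ZX (ltnW ki) Fiw.
  by move=> /(disj _ _ Fiw) ik; move: ki; rewrite ik ltnn.
- move=> i w; rewrite ltnS leq_eqVlt => /predU1P[->|ik] Fi0 Fiw.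
    rewrite Z'm// (le_trans mle)// lerD2r ler_pM2r ?invr_gt0//.
    by rewrite (@eq_Rintegral _ _ _ P (F k) X Z)// => u /set_mem Fu; rewrite (ZX k).
  rewrite Z'Z; first exact: Zle.
  by move=> /(disj _ _ Fiw) ik'; move: ik; rewrite ik' ltnn.
Qed.

(** If [Y] in [A] is uniformly within [e] of [X], then [X + e] dominates [Y] almost surely and is
    accepted by monotonicity. Conversely [X + e / 2] approximates [X]. *)
Lemma LclosureooP X : Lclosure P +oo%E A X <->
  Lp P +oo%E X /\ forall e : R, 0 < e -> A (fun w => X w + e).
Proof.
have [AL _ _ monA] := accA; split=> -[LX H]; split=> // e e0.
  have [Y [AY XY]] := H _ e0; apply: monA AY _ _.
    have /= := Lp_lincomb 1 1 (leey _) LX (Lp_cst P e (leey _)).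
    by congr Lp; apply/funext => w; rewrite !mul1r.
  by apply: filterS (Ldistoo_lt XY) => w; rewrite ler_norml => /andP[]; lra.
exists (fun w => X w + e / 2); split; first by apply: H; lra.
apply: (@le_lt_trans _ _ (e / 2)%:E); last by rewrite lte_fin; lra.
apply: Ldistoo_le; apply: aeW => w.
by rewrite opprD addNKr normrN ger0_norm; lra.
Qed.

(** Applied to the masses of the level sets: dividing by the mass of a non-null one then enlarges an
    $L^1$ error by a bounded factor only. *)
Lemma pos_lower_bound (f : nat -> R) (k : nat) :
  exists2 q, 0 < q & forall i, (i < k)%N -> 0 < f i -> q <= f i.
Proof.
elim: k => [|k [q q0 qf]]; first by exists 1.
have [f0|f0] := ltP 0 (f k); last first.
  exists q => // i; rewrite ltnS leq_eqVlt => /predU1P[->|]; last exact: qf.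
  by rewrite ltNge f0.
exists (Num.min q (f k)); first by rewrite lt_min q0.
move=> i; rewrite ltnS leq_eqVlt => /predU1P[->|ik] fi; rewrite ge_min ?lexx ?orbT//.
by rewrite qf.
Qed.

(* A bounded [L^p]-limit of elements of [A] is a uniform one: on the level
   sets of the limit [X], conditional means converge uniformly, and [A] is
   stable under conditional means up to an arbitrarily small constant. *)
Lemma Lclosure_bounded (p : R) X : 1 <= p -> Lclosure P p%:E A X ->
  Lp P +oo%E X -> Lclosure P +oo%E A X.
Proof.
move=> p1 [LpX clX] LX; apply/LclosureooP; split=> // e e0.
have [AL _ _ monA] := accA.
have [n Xn] := trunc_ae LX.
have mX : measurable_fun setT X by case: LX.
pose X0 := trunc n X.
have mX0 : measurable_fun setT X0 by exact: measurable_trunc.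
have X0n w : - n%:R <= X0 w <= n%:R by rewrite -ler_norml trunc_bound.
(* One third each for the width of a level set, for the distance of [Y0] to [X0] in conditional
   mean, and for the averaging error. *)
pose del := e / 3.
have del0 : 0 < del by rewrite divr_gt0.
pose lev w := Num.truncn ((X0 w + n%:R) / del).
pose F i := [set w | - n%:R + i%:R * del <= X0 w < - n%:R + i.+1%:R * del].
have mF i : measurable (F i).
  rewrite (_ : F i = setT `&` X0 @^-1` `[- n%:R + i%:R * del, - n%:R + i.+1%:R * del[%classic).
    by apply: mX0 => //; exact: measurable_itv.
  by rewrite setTI; apply/seteqP; split=> w /=; rewrite in_itv.
have Flev w i : F i w <-> lev w = i.
  have h : 0 <= (X0 w + n%:R) / del.
    by rewrite divr_ge0// ?(ltW del0)//; have /andP[] := X0n w; lra.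
  have := truncn_itv h; rewrite -/(lev w) ler_pdivlMr// ltr_pdivrMr// => /andP[h1 h2].
  split=> [/= /andP[h3 h4]|<-]; last by apply/andP; split; lra.
  have aux (a b : nat) : a%:R * del < b.+1%:R * del -> (a <= b)%N.
    by rewrite ltr_pM2r// ltr_nat ltnS.
  by apply/eqP; rewrite eqn_leq; apply/andP; split; apply: aux; lra.
have tF : trivIset setT F.
  apply/trivIsetP => i j _ _ /eqP ij; apply/seteqP; split=> // w [/Flev li /Flev lj].
  by apply: ij; rewrite -li -lj.
pose k := (Num.truncn (n%:R *+ 2 / del)).+1.
have levk w : (lev w < k)%N.
  rewrite ltnS; apply: le_truncn; rewrite ler_pM2r ?invr_gt0//.
  by have /andP[] := X0n w; rewrite mulr2n; lra.
have [q q0 qF] := pos_lower_bound (fun i => prob (F i)) k.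
(* The $L^p$ distance bounds the $L^1$ distance; divided by a mass of at least [q], it remains below
   [del]. *)
have [Y [AY XY]] := clX (del * q) (mulr_gt0 del0 q0).
have LY := AL _ AY.
have mY : measurable_fun setT Y by case: LY.
have [n' Yn'] := trunc_ae LY.
pose Y0 := trunc n' Y.
have mY0 : measurable_fun setT Y0 by exact: measurable_trunc.
have AY0 : A Y0.
  apply: monA AY _ _; last by apply: filterS Yn' => w; rewrite /Y0 => ->.
  by apply/LpooP; split=> //; exists n'%:R; apply: aeW => w; exact: trunc_bound.
have intXY : (\int[P]_w `|X0 w - Y0 w|%:E < (del * q)%:E)%E.
  apply: le_lt_trans XY; rewrite /Ldist.
  apply: le_trans (integral_le_Lnorm P p1 _) _; first exact: measurable_funB.
  apply: ae_le_Lnorm => //; [exact: measurable_funB|exact: measurable_funB|].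
  by apply: filterS2 Xn Yn' => w Xw Yw; rewrite /X0 /Y0 Xw Yw.
have [Z [AZ [K' ZK'] _ Zle]] :=
  average_on_sets k AY0 (trunc_bound n' Y) mF tF del0.
apply: monA AZ _ _.
  have /= := Lp_lincomb 1 1 (leey _) LX (Lp_cst P e (leey _)).
  by congr Lp; apply/funext => w; rewrite !mul1r.
(* There are countably many level sets, so almost every point lies in none of the null ones. *)
have Fnull : {ae P, forall w, forall i, prob (F i) = 0 -> ~ F i w}.
  apply: ae_foralln => i; have [F0|F0] := eqVneq (prob (F i)) 0; last first.
    by apply: aeW => w /eqP; rewrite (negbTE F0).
  exists (F i); split=> //; first by have := probP (mF i); rewrite F0.
  by move=> w /= /not_implyP[_ /contrapT].
apply: filterS2 Xn Fnull => w X0X nF.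
set i := lev w; have Fi : F i w by apply/Flev.
have Fi0 : 0 < prob (F i).
  rewrite lt0r prob_ge0 andbT; apply/negP => /eqP /nF; exact.
apply: (le_trans (Zle i w (levk w) Fi0 Fi)); rewrite -X0X.
suff : (\int[P]_(w in F i) Y0 w) / prob (F i) <= - n%:R + i.+1%:R * del + del.
  have e3 : e = 3 * del by rewrite /del mulrC divfK.
  have /andP[h1 _] := Fi; rewrite -[trunc n X w]/(X0 w) e3; lra.
rewrite ler_pdivrMr// mulrDl.
have bX0 : P.-integrable (F i) (EFin \o X0).
  by apply: (@bounded_integrable _ _ (- n%:R) n%:R).
have bY0 : P.-integrable (F i) (EFin \o Y0).
  by apply: (@bounded_integrable _ _ (- n'%:R) n'%:R) => // u _;
    rewrite -ler_norml trunc_bound.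
have bD : P.-integrable (F i) (EFin \o (fun u => `|X0 u - Y0 u|)).
  apply: (@bounded_integrable _ _ 0 (n%:R + n'%:R)) => //.
    by apply: measurableT_comp => //; exact: measurable_funB.
  by move=> u _; rewrite normr_ge0/= (le_trans (ler_normB _ _))// lerD// trunc_bound.
have bc (c : R) : P.-integrable (F i) (EFin \o cst c).
  by apply: (@bounded_integrable (cst c) _ c c) => // u _; rewrite /= lexx.
pose c := - n%:R + i.+1%:R * del.
have : \int[P]_(u in F i) Y0 u <=
    \int[P]_(u in F i) (c + `|X0 u - Y0 u|).
  apply: le_Rintegral => //.
    by rewrite (_ : EFin \o _ = (EFin \o cst c) \+ (EFin \o (fun u => `|X0 u - Y0 u|)))//;
      exact: integrableD.
  move=> u /= /andP[_ /ltW]; rewrite -/c => h.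
  have := ler_norm (- (X0 u - Y0 u)); rewrite normrN; lra.
rewrite (@RintegralD _ _ _ P (F i) (cst c) (fun u => `|X0 u - Y0 u|))// Rintegral_cst// -[X in c * X]/(prob (F i)).
move=> /le_trans; apply; rewrite lerD2l.
apply: (@le_trans _ _ (del * q)); last first.
  by rewrite ler_pM2l//; apply: qF => //; exact: levk.
rewrite -lee_fin fineK; last exact: integrable_fin_num.
apply: ltW; apply: le_lt_trans intXY; apply: ge0_subset_integral => //.
by apply/measurable_EFinP; apply: measurableT_comp => //; exact: measurable_funB.
Qed.

End averaging.
End Nonatomic.

(** * Convexity and continuity of risk measures *)

Section RiskMeasure.
Context {d : measure_display} {T : measurableType d} {R : realType}.
Variable P : probability T R.
Variables (q : \bar R) (B : set (T -> R)) (S0 : R) (ST : T -> R).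
Hypotheses (q1 : (1 <= q)%E) (accB : acceptance_set P q B)
  (tS : traded_asset P S0 ST) (LS : Lp P q ST).
Implicit Types (X Y : T -> R) (m c : R).

Let S0_gt0 : 0 < S0. Proof. by case: tS. Qed.

Lemma Lp_shift X c : Lp P q X -> Lp P q (fun w => X w + c * ST w).
Proof.
move=> LX; have := Lp_lincomb 1 c q1 LX LS.
by congr Lp; apply/funext => w; rewrite mul1r.
Qed.

Lemma acceptance_shift X m m' : Lp P q X -> m <= m' ->
  B (fun w => X w + m / S0 * ST w) -> B (fun w => X w + m' / S0 * ST w).
Proof.
have [_ _ _ monB] := accB; move=> LX mm' BX; apply: monB BX _ _.
  exact: Lp_shift.
have [_ _ ST0 _] := tS; apply: filterS ST0 => w ST0.
by rewrite lerD2l ler_wpM2r// ler_wpM2r// invr_ge0 ltW.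
Qed.

(** The admissible amounts form an up-set, because $S_0>0$ and $S_T\ge 0$ almost surely. Everything
    strictly above the infimum is therefore admissible, but the infimum itself may not be; hence the
    slack [e] in later proofs. *)
Lemma mem_of_rho_lt X m : Lp P q X -> (rho B S0 ST X < m%:E)%E ->
  B (fun w => X w + m / S0 * ST w).
Proof.
move=> LX /ereal_inf_lt[_ [m' Bm' <-]]; rewrite lte_fin => /ltW mm'.
exact: acceptance_shift Bm'.
Qed.

Lemma rho_le_of_mem X m : B (fun w => X w + m / S0 * ST w) ->
  (rho B S0 ST X <= m%:E)%E.
Proof. by move=> Bm; apply: ereal_inf_lbound; exists m. Qed.

Hypothesis cB : convex_set B.
Hypothesis finB : forall X, Lp P q X -> rho B S0 ST X \is a fin_num.
Local Notation r X := (fine (rho B S0 ST X)).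

Lemma finrho_le X m : Lp P q X -> B (fun w => X w + m / S0 * ST w) -> r X <= m.
Proof.
by move=> LX /rho_le_of_mem; rewrite -[X in (X <= _)%E](fineK (finB LX)).
Qed.

Lemma finrho_lt X m : Lp P q X -> r X < m -> B (fun w => X w + m / S0 * ST w).
Proof.
by move=> LX h; apply: mem_of_rho_lt => //; rewrite -(fineK (finB LX)) lte_fin.
Qed.

Lemma finrho_anti X Y : Lp P q X -> Lp P q Y ->
  {ae P, forall w, X w <= Y w} -> r Y <= r X.
Proof.
move=> LX LY XY; apply/ler_addgt0Pr => e e0.
have [_ _ _ monB] := accB.
apply: finrho_le => //; apply: (monB (fun w => X w + (r X + e) / S0 * ST w)).
- by apply: finrho_lt => //; rewrite ltrDl.
- exact: Lp_shift.
- by apply: filterS XY => w; rewrite lerD2r.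
Qed.

Lemma finrho_convex X Y (l : R) : Lp P q X -> Lp P q Y -> 0 <= l <= 1 ->
  r (fun w => l * X w + (1 - l) * Y w) <= l * r X + (1 - l) * r Y.
Proof.
move=> LX LY l01; apply/ler_addgt0Pr => e e0.
apply: finrho_le; first exact: Lp_lincomb.
have hX : B (fun w => X w + (r X + e) / S0 * ST w).
  by apply: finrho_lt => //; rewrite ltrDl.
have hY : B (fun w => Y w + (r Y + e) / S0 * ST w).
  by apply: finrho_lt => //; rewrite ltrDl.
have := cB hX hY l01.
by congr B; apply/funext => w; rewrite -!mulrA; ring.
Qed.

Lemma finrho_shift X c : Lp P q X ->
  r (fun w => X w + c / S0 * ST w) = r X - c.
Proof.
have half Y k : Lp P q Y -> r (fun w => Y w + k / S0 * ST w) <= r Y - k.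
  move=> LY; apply/ler_addgt0Pr => e e0.
  apply: finrho_le; first exact: Lp_shift.
  have : B (fun w => Y w + (r Y + e) / S0 * ST w).
    by apply: finrho_lt => //; rewrite ltrDl.
  by congr B; apply/funext => w; rewrite -!mulrA; ring.
move=> LX; apply/eqP; rewrite eq_le half//=.
(* The reverse inequality is the same bound for the shifted position and the amount [- c]. *)
have := half _ (- c) (Lp_shift (c / S0) LX).
rewrite (_ : (fun w => _) = X); first by lra.
by apply/funext => w; rewrite -!mulrA; ring.
Qed.

End RiskMeasure.

(** * Continuity of convex antitone functionals on $L^p$ *)

Section NamiokaKlee.
Context {d : measure_display} {T : measurableType d} {R : realType}.
Variable P : probability T R.
Variables (p : R) (F : (T -> R) -> R).
Hypothesis p1 : 1 <= p.
Hypothesis antiF : forall X Y, Lp P p%:E X -> Lp P p%:E Y ->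
  {ae P, forall w, X w <= Y w} -> F Y <= F X.
Hypothesis convF : forall X Y (l : R), Lp P p%:E X -> Lp P p%:E Y ->
  0 <= l <= 1 -> F (fun w => l * X w + (1 - l) * Y w) <= l * F X + (1 - l) * F Y.
Local Notation N X := ('N[P]_(p%:E) [EFin \o X])%E.
Let pe1 : (1 <= p%:E)%E. Proof. by rewrite lee_fin. Qed.

Let LpD X Y (a b : R) : Lp P p%:E X -> Lp P p%:E Y ->
  Lp P p%:E (fun w => a * X w + b * Y w).
Proof. exact: Lp_lincomb. Qed.

(* A sequence violating upper semicontinuity could be chosen to converge so
   fast that [n * U n] has a common majorant [Z] in [L^p]; convexity along the
   segment from [X] to [X - Z] excludes this. *)
Lemma anti_convex_usc X (e : R) : Lp P p%:E X -> 0 < e ->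
  exists2 del, 0 < del & forall U, Lp P p%:E U -> (N U < del%:E)%E ->
    F (fun w => X w + U w) <= F X + e.
Proof.
move=> LX e0; apply: contrapT => H.
(* The factor $1/(n+1)$ in the radius absorbs the later multiplication by $n+1$ and leaves the
   summable bound $2^{-(n+1)}$ that the majorant requires. *)
have H' n : exists U, [/\ Lp P p%:E U, (N U < (2 ^- n.+1 / n.+1%:R)%:E)%E &
    F X + e < F (fun w => X w + U w)].
  apply: contrapT => nU; apply: H; exists (2 ^- n.+1 / n.+1%:R).
    by rewrite divr_gt0 ?invr_gt0 ?exprn_gt0.
  move=> U LU NU; rewrite leNgt; apply/negP => h; apply: nU.
  by exists U.
have [U UP] := choice H'.
pose V n w := n.+1%:R * U n w.
have LV n : Lp P p%:E (V n).
  have [LU _ _] := UP n; have := LpD n.+1%:R 0 LU LU.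
  by congr Lp; apply/funext => w; rewrite mul0r addr0.
have NV n : (N (V n) <= (2 ^- n.+1)%:E)%E.
  have [LU /ltW NU _] := UP n; rewrite (LnormZ_Lp p1)//.
  have := Lnorm_ge0 P p%:E (EFin \o U n); move: NU.
  case: (N (U n)) => [s| |]//; rewrite -EFinM !lee_fin normr_nat => + _.
  by rewrite ler_pdivlMr// mulrC.
have [Z [LZ ZV]] := Lp_majorant p1 LV NV.
have LXZ : Lp P p%:E (fun w => X w - Z w).
  by have := LpD 1 (-1) LX LZ; congr Lp; apply/funext => w; rewrite mul1r mulN1r.
pose D := F (fun w => X w - Z w) - F X.
have [n _ /(_ n (leqnn n)) /= hn] := nbhs_infty_gtr (D / e).
have [LU _ FU] := UP n.
have n0 : 0 < n.+1%:R :> R by [].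
(* $|U_n|\le Z/(n+1)$ gives $X+U_n\ge X-Z/(n+1)$, a point of the segment from $X$ to $X-Z$.
   Convexity bounds the increase there by $D/(n+1)$, which is at most [e] for the chosen [n]. *)
have : F (fun w => X w + U n w) <=
    F (fun w => n.+1%:R^-1 * (X w - Z w) + (1 - n.+1%:R^-1) * X w).
  apply: antiF.
  - exact: LpD.
  - by have := LpD 1 1 LX LU; congr Lp; apply/funext => w; rewrite !mul1r.
  apply: filterS (ZV n) => w; rewrite /V normrM ger0_norm// => ZVw.
  have : - U n w <= Z w / n.+1%:R.
    rewrite ler_pdivlMr// mulrC; apply: le_trans ZVw; rewrite ler_pM2l//.
    by rewrite -normrN ler_norm.
  by move: (n.+1%:R^-1) => a; lra.
move=> /(lt_le_trans FU) /lt_le_trans /(_ (convF LXZ LX _)).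
rewrite invr_ge0 ltW//= invf_le1// ler1n => /(_ isT).
suff : n.+1%:R^-1 * D <= e by rewrite /D; move: (n.+1%:R^-1) => a; lra.
rewrite mulrC ler_pdivrMr// mulrC -ler_pdivrMr//.
by rewrite (le_trans (ltW hn))// ler_nat.
Qed.

(** The lower bound follows from the upper one at [- U], since [X] is the midpoint of [X + U] and
    [X - U]. *)
Lemma anti_convex_continuous X (e : R) : Lp P p%:E X -> 0 < e ->
  exists2 del, 0 < del & forall U, Lp P p%:E U -> (N U < del%:E)%E ->
    `|F (fun w => X w + U w) - F X| <= e.
Proof.
move=> LX e0; have [del del0 H] := anti_convex_usc LX e0.
exists del => // U LU NU; have h1 := H _ LU NU.
have LNU : Lp P p%:E (fun w => - U w).
  by have := LpD (-1) 0 LU LU; congr Lp; apply/funext => w; rewrite mulN1r mul0r addr0.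
have NNU : (N (fun w => (- U w)%R) < del%:E)%E.
  by rewrite -oppe_Lnorm (_ : \- _ = EFin \o U)%E//; apply/funext => w /=; rewrite opprK.
have h2 := H _ LNU NNU.
have LXU : Lp P p%:E (fun w => X w + U w).
  by have := LpD 1 1 LX LU; congr Lp; apply/funext => w; rewrite !mul1r.
have LXNU : Lp P p%:E (fun w => X w + - U w).
  by have := LpD 1 1 LX LNU; congr Lp; apply/funext => w; rewrite !mul1r.
have := @convF _ _ 2^-1 LXU LXNU.
rewrite (_ : (fun w => _) = X); last by apply/funext => w; lra.
rewrite invr_ge0 ler0n invf_le1// ler1n => /(_ isT) h3.
by rewrite ler_norml; apply/andP; split; lra.
Qed.

End NamiokaKlee.

(** * The two closures of the acceptance set *)

Section Extension.
Context {d : measure_display} {T : measurableType d} {R : realType}.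
Variable P : probability T R.
Variables (A : set (T -> R)) (S0 : R) (ST : T -> R) (p : R).
Hypotheses (Pna : nonatomic P) (accA : acceptance_set P +oo%E A)
  (cA : convex_set A) (lawA : law_invariant P +oo%E A)
  (tS : traded_asset P S0 ST) (LS : Lp P +oo%E ST)
  (finA : forall X, Lp P +oo%E X -> rho A S0 ST X \is a fin_num)
  (p1 : 1 <= p).
Import numFieldNormedType.Exports.
Implicit Types (X Y Z U : T -> R).
Local Notation L := (Lp P +oo%E).
Local Notation Np X := ('N[P]_(p%:E) [EFin \o X])%E.
Local Notation r X := (fine (rho A S0 ST X)).
Local Notation Cp := (Lclosure P p%:E A).
Local Notation Coo := (Lclosure P +oo%E A).

Let y1 : (1 <= +oo :> \bar R)%E. Proof. exact: leey. Qed.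
Let pe1 : (1 <= p%:E)%E. Proof. by rewrite lee_fin. Qed.
Let half01 : 0 <= (2^-1 : R) <= 1.
Proof. by rewrite invr_ge0 ler0n invf_le1// ler1n. Qed.
Let AL : A `<=` L. Proof. by case: accA. Qed.
Let LLp X : L X -> Lp P p%:E X. Proof. exact: LpSoo. Qed.
Let mL X : L X -> measurable_fun setT X. Proof. by case. Qed.
Let mLp X : Lp P p%:E X -> measurable_fun setT X. Proof. by case. Qed.
Let LSp : Lp P p%:E ST. Proof. exact: LLp. Qed.
Let L0 : L (cst 0). Proof. exact: Lp_cst. Qed.
Let LB (q : \bar R) X Y : (1 <= q)%E -> Lp P q X -> Lp P q Y ->
  Lp P q (fun w => X w - Y w).
Proof.
move=> q1 LX LY; have := Lp_lincomb 1 (-1) q1 LX LY.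
by congr Lp; apply/funext => w; rewrite mul1r mulN1r.
Qed.
Let LD (q : \bar R) X Y : (1 <= q)%E -> Lp P q X -> Lp P q Y ->
  Lp P q (fun w => X w + Y w).
Proof.
move=> q1 LX LY; have := Lp_lincomb 1 1 q1 LX LY.
by congr Lp; apply/funext => w; rewrite !mul1r.
Qed.
Let LZ (q : \bar R) X (a : R) : (1 <= q)%E -> Lp P q X -> Lp P q (fun w => a * X w).
Proof.
move=> q1 LX; have := Lp_lincomb a 0 q1 LX LX.
by congr Lp; apply/funext => w; rewrite mul0r addr0.
Qed.

Let r_convex X Y (l : R) : L X -> L Y -> 0 <= l <= 1 ->
  r (fun w => l * X w + (1 - l) * Y w) <= l * r X + (1 - l) * r Y.
Proof. exact: finrho_convex y1 accA tS LS cA finA X Y l. Qed.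
Let r_shift X (c : R) : L X -> r (fun w => X w + c / S0 * ST w) = r X - c.
Proof. exact: finrho_shift y1 accA tS LS finA X c. Qed.

(** Forwards, [X] is a convex combination of $X+l/(1-l)$, which is accepted, and of $X-1$ with small
    weight $l$. Backwards, a small amount of the bounded payoff [ST] makes [X] acceptable and is
    dominated by the constant [e]. *)
Lemma Lclosureoo_rho X : L X -> Coo X <-> r X <= 0.
Proof.
move=> LX; split.
  move=> /(LclosureooP accA)[_ H]; apply/ler_addgt0Pr => e e0; rewrite add0r.
  have LXt (t : R) : L (fun w => X w + t) by apply: LD => //; exact: Lp_cst.
  set K := `|r (fun w => X w + -1)| + 1.
  have K0 : 0 < K by rewrite ltr_wpDl.
  pose l := Num.min 2^-1 (e / K).
  have l0 : 0 < l by rewrite lt_min invr_gt0 ltr0n divr_gt0.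
  have l2 : l <= 2^-1 by rewrite ge_min lexx.
  have l1 : 0 < 1 - l by lra.
  have AX : A (fun w => X w + l / (1 - l)) by apply: H; rewrite divr_gt0.
  have rX : r (fun w => X w + l / (1 - l)) <= 0.
    apply: (finrho_le finA) => //; move: AX; congr A.
    by apply/funext => w; rewrite !mul0r addr0.
  have := @r_convex _ _ (1 - l) (LXt (l / (1 - l))) (LXt (-1)).
  rewrite (_ : (fun w => _) = X); last first.
    by apply/funext => w; rewrite mulrDr (mulrC (1 - l) (l / _)) divfK ?gt_eqF//; ring.
  have -> : 0 <= 1 - l <= 1 by apply/andP; split; lra.
  move=> /(_ isT) /le_trans; apply.
  have : l * r (fun w => X w + -1) <= l * K.
    by rewrite ler_pM2l// /K (le_trans (ler_norm _))// lerDl.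
  have : l * K <= e by rewrite -ler_pdivlMr// ge_min lexx orbT.
  have : (1 - l) * r (fun w => X w + l / (1 - l)) <= 0 by rewrite pmulr_rle0.
  rewrite subKr; lra.
move=> rX; apply/(LclosureooP accA); split=> // e e0.
have [_ _ _ monA] := accA.
have S00 : 0 < S0 by case: tS.
have /LpooP[mS [M SM]] := LS.
(* Chosen so that $m/S_0$ times the bound $|M|+1$ of [ST] equals [e]. *)
pose m := e * S0 / (`|M| + 1).
have M0 : 0 < `|M| + 1 by rewrite ltr_wpDl.
have m0 : 0 < m by rewrite divr_gt0// mulr_gt0.
have AX : A (fun w => X w + m / S0 * ST w).
  by apply: (finrho_lt y1 accA tS LS finA) => //; exact: le_lt_trans rX m0.
apply: monA AX _ _; first by apply: LD => //; exact: Lp_cst.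
apply: filterS SM => w SMw; rewrite lerD2l.
apply: (@le_trans _ _ (m / S0 * (`|M| + 1))).
  apply: ler_wpM2l; first by apply: divr_ge0; exact: ltW.
  apply: (le_trans (ler_norm _)); apply: (le_trans SMw).
  by apply: (le_trans (ler_norm _)); rewrite lerDl.
by rewrite /m mulrAC divfK ?gt_eqF// mulfK ?gt_eqF.
Qed.

Lemma subset_Lclosure X : A X -> Cp X.
Proof.
move=> AX; split; first exact/LLp/AL.
move=> e e0; exists X; split=> //; rewrite /Ldist.
have -> : (fun w => X w - X w) = (fun=> 0) by apply/funext => w; rewrite subrr.
by rewrite (Lnorm_cst P p1) normr0 lte_fin.
Qed.

Lemma Lclosure_closed X : Lp P p%:E X ->
  (forall e : R, 0 < e -> exists Y, Cp Y /\ (Ldist P p%:E X Y < e%:E)%E) -> Cp X.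
Proof.
move=> LX H; split=> // e e0.
have e2 : 0 < e / 2 by rewrite divr_gt0.
have [Y [[LY clY] XY]] := H _ e2; have [Z [AZ YZ]] := clY _ e2.
exists Z; split=> //; apply: le_lt_trans (Ldist_triangle P p1 (mLp LX) (mLp LY) (mL (AL AZ))) _.
by rewrite (splitr e) EFinD lteD.
Qed.

Lemma Lclosure_on_Loo X : L X -> Cp X <-> Coo X.
Proof.
move=> LX; split=> [CX|/(LclosureooP accA)[_ H]].
  exact: Lclosure_bounded p1 CX LX.
apply: Lclosure_closed; first exact: LLp.
move=> e e0; have e2 : 0 < e / 2 by rewrite divr_gt0.
exists (fun w => X w + e / 2); split; first exact/subset_Lclosure/H.
have mXe : measurable_fun setT (fun w => X w + e / 2).
  by apply: mL; apply: LD => //; exact: Lp_cst.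
apply: le_lt_trans (Ldist_le_oo p1 (mL LX) mXe (e := e / 2) _) _.
  by apply: aeW => w; rewrite opprD addNKr normrN ger0_norm// ltW.
by rewrite ger0_norm ?ltW// lte_fin; lra.
Qed.

Lemma Lclosure_rho X : L X -> Cp X <-> r X <= 0.
Proof. by move=> LX; rewrite Lclosure_on_Loo//; exact: Lclosureoo_rho. Qed.

(** * Conditions at the origin *)

Definition rho_continuous0 := forall e : R, 0 < e -> exists2 del, 0 < del &
  forall X, L X -> (Np X < del%:E)%E -> `|r X - r (cst 0)| <= e.

(** The weakest form: each of the equivalent statements leads to this one-sided bound, and the
    extension is built from it alone. *)
Definition rho_bounded0 := exists2 del, 0 < del &
  forall X, L X -> (Np X < del%:E)%E -> r X <= r (cst 0) + 1.

Lemma continuous0_bounded0 : rho_continuous0 -> rho_bounded0.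
Proof.
move=> /(_ _ ltr01)[del del0 H]; exists del => // X LX NX.
by have := ler_normlW (H _ LX NX); lra.
Qed.

Definition seq_continuous0 := forall Xn : nat -> T -> R, (forall n, L (Xn n)) ->
  (fun n => Np (Xn n)) @ \oo --> 0%E ->
  (fun n => rho A S0 ST (Xn n)) @ \oo --> rho A S0 ST (cst 0).

Lemma continuous0_seq : rho_continuous0 -> seq_continuous0.
Proof.
move=> H Xn LXn NXn; rewrite -(fineK (finA L0)).
apply/fine_cvgP; split; first by apply: nearW => n; exact: finA.
apply/cvgrPdist_le => e e0; have [del del0 Hd] := H _ e0.
have : \forall n \near \oo, (Np (Xn n) < del%:E)%E.
  exact: (NXn _ (@nbhs_open_ereal_lt _ _ (fun=> del) del0)).
by apply: filterS => n NX; rewrite /= distrC; exact: Hd.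
Qed.

Lemma seq_bounded0 : seq_continuous0 -> rho_bounded0.
Proof.
move=> H; apply: contrapT => nH.
have H' n : exists X, [/\ L X, (Np X < (n.+1%:R^-1)%:E)%E &
    r (cst 0) + 1 < r X].
  apply: contrapT => nX; apply: nH; exists n.+1%:R^-1; first by rewrite invr_gt0.
  move=> X LX NX; rewrite leNgt; apply/negP => h; apply: nX; by exists X.
have [Xn XnP] := choice H'.
have LXn n : L (Xn n) by case: (XnP n).
have NXn : (fun n => Np (Xn n)) @ \oo --> 0%E.
  apply: (@squeeze_cvge _ _ _ _ (cst 0%E) _ (fun n => (n.+1%:R^-1)%:E)).
  - by apply: nearW => n; rewrite Lnorm_ge0/= ltW//; case: (XnP n).
  - exact: cvg_cst.
  - by apply: cvg_EFin; [exact: nearW|exact: cvg_harmonic].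
have := H Xn LXn NXn; rewrite -(fineK (finA L0)) => /fine_cvg cv.
move/cvgrPdist_lt: cv => /(_ _ ltr01)[n _ /(_ n (leqnn n)) /=].
by rewrite distrC => /ltr_normlW; have [_ _] := XnP n; lra.
Qed.

(** The extension is finite, convex and antitone on $L^p$, hence continuous at $0$ there, and it
    agrees with $\rho$ on bounded functions. *)
Lemma finite_extension_continuous0 B :
  finite_extension P p%:E A B S0 ST -> rho_continuous0.
Proof.
move=> [accB cB finB BA] e e0.
have antiF := finrho_anti pe1 accB tS LSp finB.
have convF := finrho_convex pe1 accB tS LSp cB finB.
have [del del0 H] := anti_convex_continuous p1 antiF convF (LLp L0) e0.
exists del => // X LX NX; have := H X (LLp LX) NX.
by rewrite (_ : (fun w => _) = X) ?BA//; apply/funext => w; rewrite /= add0r.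
Qed.

(** * Interior points of the closures *)

Lemma bounded0_interior : rho_bounded0 -> has_interior P +oo%E p%:E Coo.
Proof.
(* [k] is the upper bound on the ball around $0$; adding this capital moves the ball into the set
   where $\rho\le 0$. *)
move=> [del del0 H]; set k := r (cst 0) + 1.
pose X1 := fun w => cst 0 w + k / S0 * ST w.
have LX1 : L X1 by apply: (Lp_shift y1 LS).
exists X1; split; first by apply/Lclosureoo_rho => //; rewrite /X1 r_shift// /k; lra.
exists del; split=> // Y LY YX1.
have LU : L (fun w => Y w - X1 w) by exact: LB.
apply/Lclosureoo_rho => //.
rewrite (_ : Y = fun w => (Y w - X1 w) + k / S0 * ST w); last first.
  by apply/funext => w; rewrite /X1 /= add0r subrK.
by rewrite r_shift// subr_le0; exact: H.
Qed.

(** On a ball around [X0] the functional is at most $0$. Writing $V =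
    2t\,[\frac12(X_0+V/t)+\frac12(-X_0)]+(1-2t)\,0$ and using convexity gives
    $\rho(V)\le\rho(0)+t(\rho(-X_0)-2\rho(0))$ for small [V]. The lower bound follows because $0$ is
    the midpoint of $X$ and $-X$. *)
Lemma interior_continuous0 : has_interior P +oo%E p%:E Coo -> rho_continuous0.
Proof.
move=> [X0 [CX0 [del [del0 H]]]] e e0.
have LX0 : L X0 by case: CX0.
have usc : exists2 del', 0 < del' & forall X, L X -> (Np X < del'%:E)%E ->
    r X <= r (cst 0) + e.
  (* The last term of the estimate is at most [t * K], so [t] is taken to be at most [e / K];
     $t\le\frac12$ keeps the weight $2t$ admissible. *)
  set K := `|r (fun w => - X0 w) - 2 * r (cst 0)| + 1.
  have K0 : 0 < K by rewrite ltr_wpDl.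
  pose t := Num.min 2^-1 (e / K).
  have t0 : 0 < t by rewrite lt_min invr_gt0 ltr0n divr_gt0.
  have t2 : t <= 2^-1 by rewrite ge_min lexx.
  have tK : t * K <= e by rewrite -ler_pdivlMr// ge_min lexx orbT.
  exists (t * del); first exact: mulr_gt0.
  move=> V LV NV.
  have LVt : L (fun w => t^-1 * V w) by exact: LZ.
  have LN : L (fun w => - X0 w).
    by have := LZ (-1) y1 LX0; congr Lp; apply/funext => w; rewrite mulN1r.
  have LXV : L (fun w => X0 w + t^-1 * V w) by exact: LD.
  have rXV : r (fun w => X0 w + t^-1 * V w) <= 0.
    apply/Lclosureoo_rho => //; apply: H => //; rewrite /Ldist.
    rewrite (_ : (fun w => _) = fun w => t^-1 * V w); last first.
      by apply/funext => w; rewrite addrC addKr.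
    rewrite (LnormZ_Lp p1)//; last exact: LLp.
    move: NV; have := Lnorm_ge0 P p%:E (EFin \o V).
    case: (Np V) => [s| |]//; rewrite -EFinM !lte_fin => _.
    by rewrite gtr0_norm ?invr_gt0// => h; rewrite mulrC ltr_pdivrMr// mulrC.
  have h1 := @r_convex _ _ 2^-1 LXV LN.
  have Lh : L (fun w => 2^-1 * (X0 w + t^-1 * V w) + (1 - 2^-1) * - X0 w).
    exact: Lp_lincomb.
  have h2 := @r_convex _ _ (2 * t) Lh L0.
  rewrite (_ : (fun w => _ + _ * cst 0 w) = V) in h2; last first.
    apply/funext => w /=; rewrite mulr0 addr0.
    have -> : 2^-1 * (X0 w + t^-1 * V w) + (1 - 2^-1) * - X0 w = 2^-1 * (t^-1 * V w) by lra.
    by rewrite mulrACA mulfV ?pnatr_eq0// mul1r mulrA mulfV ?gt_eqF// mul1r.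
  have t01 : 0 <= 2 * t <= 1 by apply/andP; split; lra.
  apply: (le_trans (h2 t01)).
  have {}h1 := h1 half01.
  have h3 : 2 * t * r (fun w => 2^-1 * (X0 w + t^-1 * V w) + (1 - 2^-1) * - X0 w) <=
      2 * t * (2^-1 * r (fun w => - X0 w)).
    by rewrite ler_pM2l ?mulr_gt0//; lra.
  have h4 : t * (r (fun w => - X0 w) - 2 * r (cst 0)) <= t * K.
    by rewrite ler_pM2l// /K (le_trans (ler_norm _))// lerDl.
  lra.
have [del' del'0 Hd] := usc; exists del' => // X LX NX.
have h1 := Hd _ LX NX.
have LN : L (fun w => - X w).
  by have := LZ (-1) y1 LX; congr Lp; apply/funext => w; rewrite mulN1r.
have h2 : r (fun w => - X w) <= r (cst 0) + e.
  apply: Hd => //.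
  by rewrite -oppe_Lnorm (_ : \- _ = EFin \o X)%E//; apply/funext => w /=; rewrite opprK.
have := @r_convex _ _ 2^-1 LX LN half01.
rewrite (_ : (fun w => 2^-1 * X w + _) = cst 0); last first.
  by apply/funext => w; rewrite /cst; lra.
by move=> h3; rewrite ler_norml; apply/andP; split; lra.
Qed.

(** Centre and radius are kept: a point of the ball is a limit of truncations lying in the ball, and
    $\mathrm{Cl}_p(\mathcal{A})$ is closed. *)
Lemma interior_oo_p : has_interior P +oo%E p%:E Coo -> has_interior P p%:E p%:E Cp.
Proof.
move=> [X0 [CX0 [e [e0 H]]]]; have LX0 : L X0 by case: CX0.
exists X0; split; first exact/Lclosure_on_Loo.
exists e; split=> // Y LY YX0.
have [s Es se] : exists2 s : R, Ldist P p%:E Y X0 = s%:E & s < e.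
  move: YX0; have := Lnorm_ge0 P p%:E (EFin \o (fun w => Y w - X0 w)).
  by rewrite -/(Ldist _ _ _ _); case: (Ldist _ _ _ _) => [s| |]//; exists s.
apply: Lclosure_closed => // e' e'0.
(* The slack [e - s] keeps the truncation in the ball, and [e'] makes it a good approximation. *)
have m0 : 0 < Num.min e' (e - s) by rewrite lt_min e'0 subr_gt0.
have [n [Ln Yn]] := Lp_trunc_approx p1 LY m0.
exists (trunc n Y); split; last first.
  by apply: (lt_le_trans Yn); rewrite lee_fin ge_min lexx.
apply/Lclosure_on_Loo => //; apply: H => //.
apply: le_lt_trans (Ldist_triangle P p1 (mL Ln) (mLp LY) (mL LX0)) _.
rewrite Es (Ldist_sym P p).
have : (Ldist P p%:E Y (trunc n Y) < (e - s)%:E)%E.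
  by apply: (lt_le_trans Yn); rewrite lee_fin ge_min lexx orbT.
case: (Ldist P p%:E Y (trunc n Y)) => [u| |]//; last first.
  by move=> _; rewrite addNye ltNyr.
by rewrite -EFinD !lte_fin ltrBrDr.
Qed.

(** Density moves the centre to a bounded function at the cost of half the radius. *)
Lemma interior_p_oo : has_interior P p%:E p%:E Cp -> has_interior P +oo%E p%:E Coo.
Proof.
move=> [X [CX [e [e0 H]]]]; have LX : Lp P p%:E X by case: CX.
have e2 : 0 < e / 2 by rewrite divr_gt0.
have [n [Ln Xn]] := Lp_trunc_approx p1 LX e2.
exists (trunc n X); split.
  apply/Lclosure_on_Loo => //; apply: H; first exact: LLp.
  by rewrite (Ldist_sym P p); apply: (lt_trans Xn); rewrite lte_fin; lra.
exists (e / 2); split=> // Y LY YX; apply/Lclosure_on_Loo => //; apply: H; first exact: LLp.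
apply: le_lt_trans (Ldist_triangle P p1 (mL LY) (mL Ln) (mLp LX)) _.
by rewrite (splitr e) EFinD lteD// (Ldist_sym P p).
Qed.

(** * The closure as the acceptance set of the extension *)

Lemma Lclosure_convex X Y (l : R) : Cp X -> Cp Y -> 0 <= l <= 1 ->
  Cp (fun w => l * X w + (1 - l) * Y w).
Proof.
move=> [LX clX] [LY clY] l01; split; first exact: Lp_lincomb.
move=> e e0; have e2 : 0 < e / 2 by rewrite divr_gt0.
have [X' [AX' XX']] := clX _ e2; have [Y' [AY' YY']] := clY _ e2.
exists (fun w => l * X' w + (1 - l) * Y' w); split; first exact: cA.
have LDX : Lp P p%:E (fun w => X w - X' w) by apply: LB => //; exact/LLp/AL.
have LDY : Lp P p%:E (fun w => Y w - Y' w) by apply: LB => //; exact/LLp/AL.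
have scale Z (k : R) : Lp P p%:E Z -> 0 <= k <= 1 -> (Np Z < (e / 2)%:E)%E ->
    (Np (fun w => (k * Z w)%R) < (e / 2)%:E)%E.
  move=> LpZ /andP[k0 k1]; rewrite (LnormZ_Lp p1)//; apply: le_lt_trans.
  by rewrite ger0_norm// gee_pMl ?Lnorm_ge0.
rewrite /Ldist (_ : (fun w => _) =
    fun w => l * (X w - X' w) + (1 - l) * (Y w - Y' w)); last first.
  by apply/funext => w; ring.
apply: le_lt_trans (LnormD P p1 _ _) _.
- by apply: mLp; exact: LZ.
- by apply: mLp; exact: LZ.
rewrite [in ltRHS](splitr e) EFinD; apply: lteD; apply: scale => //.
by move: l01 => /andP[l0 l1]; apply/andP; split; lra.
Qed.

(** The difference [Y - X] may be unbounded, so its truncation is added to an approximant of [X];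
    being nonnegative and bounded, it preserves membership in [A]. *)
Lemma Lclosure_monotone X Y : Cp X -> Lp P p%:E Y -> {ae P, forall w, X w <= Y w} -> Cp Y.
Proof.
move=> [LX clX] LY XY; split=> // e e0.
have e2 : 0 < e / 2 by rewrite divr_gt0.
have [X' [AX' XX']] := clX _ e2.
have LD' : Lp P p%:E (fun w => Y w - X w) by exact: LB.
have [n [Ln Dn]] := Lp_trunc_approx p1 LD' e2.
exists (fun w => X' w + trunc n (fun w => Y w - X w) w); split.
  have LX' := AL AX'.
  have [_ _ _ monA] := accA; apply: monA AX' _ _; first exact: LD.
  by apply: filterS XY => w XYw; rewrite lerDl trunc_ge0// subr_ge0.
set D := trunc n _ in Ln Dn *.
rewrite /Ldist (_ : (fun w => _) =
    fun w => (X w - X' w) + ((Y w - X w) - D w)); last first.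
  by apply/funext => w; ring.
apply: le_lt_trans (LnormD P p1 _ _) _.
- by apply: measurable_funB; [exact: mLp|exact/mL/AL].
- by apply: measurable_funB; [exact: mLp|exact: mL].
by rewrite [in ltRHS](splitr e) EFinD; apply: lteD.
Qed.

Lemma bounded0_finite_extension : rho_bounded0 ->
  finite_extension P p%:E A Cp S0 ST.
Proof.
move=> [del del0 H].
have Lsh (q : \bar R) X (c : R) : (1 <= q)%E -> Lp P q ST -> Lp P q X ->
    Lp P q (fun w => X w + c / S0 * ST w).
  by move=> q1 LSq LX; apply: LD => //; exact: LZ.
have accC : acceptance_set P p%:E Cp.
  split.
  - by move=> X [].
  - by have [_ [X AX] _ _] := accA; exists X; exact: subset_Lclosure.
  (* The shift gives this position the value $\rho=1>0$, so it lies outside the closure. *)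
  - pose X := fun w => cst 0 w + (r (cst 0) - 1) / S0 * ST w.
    have LX : L X by exact: Lsh.
    exists X; split; first exact: LLp.
    by move=> /(Lclosure_rho LX); rewrite /X r_shift// opprB addrC subrK ler10.
  - by move=> X Y; exact: Lclosure_monotone.
have upper X : Lp P p%:E X -> exists m, Cp (fun w => X w + m / S0 * ST w).
  move=> LX; have d4 : 0 < del / 4 by rewrite divr_gt0.
  have [n0 [Ln0 Xn0]] := Lp_trunc_approx p1 LX d4.
  pose V := trunc n0 X.
  (* For a fine truncation [W], write $W=\frac12(2V)+\frac12\,2(W-V)$. The distance of [W] to [V] is
     below [del / 2], so the second point lies in the ball, and the resulting bound [m] does not
     depend on [W]. *)
  pose m := 2^-1 * r (fun w => 2 * V w) + 2^-1 * (r (cst 0) + 1).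
  exists m; apply: Lclosure_closed; first exact: Lsh.
  move=> e e0; have e4 : 0 < Num.min e (del / 4) by rewrite lt_min e0.
  have [k [Lk Xk]] := Lp_trunc_approx p1 LX e4.
  pose W := trunc k X.
  exists (fun w => W w + m / S0 * ST w); split; last first.
    rewrite /Ldist (_ : (fun w => _) = fun w => X w - W w); last first.
      by apply/funext => w; ring.
    by apply: (lt_le_trans Xk); rewrite lee_fin ge_min lexx.
  apply/Lclosure_rho; first exact: Lsh.
  rewrite r_shift// subr_le0 /m.
  have L2V : L (fun w => 2 * V w) by exact: LZ.
  have LWV : L (fun w => W w - V w) by exact: LB.
  have L2WV : L (fun w => 2 * (W w - V w)) by exact: LZ.
  have r2WV : r (fun w => 2 * (W w - V w)) <= r (cst 0) + 1.
    apply: H => //; rewrite (LnormZ_Lp p1); last exact: LLp.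
    have : (Ldist P p%:E W V < (del / 2)%:E)%E.
      apply: le_lt_trans (Ldist_triangle P p1 (mL Lk) (mLp LX) (mL Ln0)) _.
      rewrite (_ : del / 2 = del / 4 + del / 4); last by lra.
      rewrite EFinD lteD// (Ldist_sym P p).
      by apply: (lt_le_trans Xk); rewrite lee_fin ge_min lexx orbT.
    have := Lnorm_ge0 P p%:E (EFin \o (fun w => W w - V w)).
    rewrite /Ldist; case: ('N[P]_ _ [_])%E => [s| |]//.
    by rewrite -EFinM !lte_fin ger0_norm// => _; lra.
  have := r_convex L2V L2WV half01.
  rewrite (_ : (fun w => _) = W); last by apply/funext => w; lra.
  by move: (r _) (r _) (r _) (r _) r2WV => x y z t; lra.
(* Finiteness from below: the midpoint of the two positions is a multiple of [ST], whose $\rho$ is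
   known, so an amount for [- X] bounds every amount for [X]. *)
have shift_le X m m' : Cp (fun w => X w + m / S0 * ST w) ->
    Cp (fun w => - X w + m' / S0 * ST w) -> 2 * r (cst 0) - m' <= m.
  move=> C1 C2.
  have := Lclosure_convex C1 C2 half01.
  rewrite (_ : (fun w => _) = fun w => cst 0 w + ((m + m') / 2) / S0 * ST w); last first.
    by apply/funext => w /=; move: (S0^-1) => s; lra.
  move=> /Lclosure_rho; rewrite r_shift// => /(_ (Lsh _ _ _ y1 LS L0)); lra.
split=> //; first by move=> X Y l; exact: Lclosure_convex.
- move=> X LX; have [m Cm] := upper X LX.
  have LNX : Lp P p%:E (fun w => - X w).
    by have := LZ (-1) pe1 LX; congr Lp; apply/funext => w; rewrite mulN1r.
  have [m' Cm'] := upper _ LNX.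
  have h1 : (rho Cp S0 ST X <= m%:E)%E by exact: rho_le_of_mem.
  have h2 : ((2 * r (cst 0) - m')%:E <= rho Cp S0 ST X)%E.
    apply: le_ereal_inf_tmp => _ [k Ck <-]; rewrite lee_fin.
    exact: shift_le Ck Cm'.
  by rewrite fin_numE; apply/andP; split; apply/eqP => E; rewrite E in h1 h2.
(* One inequality is the inclusion of [A] in its closure; the other holds because the closure adds
   only bounded positions with $\rho\le 0$. *)
move=> X LX; apply/eqP; rewrite eq_le; apply/andP; split.
  apply: le_ereal_inf_tmp => _ [m Am <-]; apply: rho_le_of_mem.
  exact: subset_Lclosure.
apply: le_ereal_inf_tmp => _ [m Cm <-].
rewrite -(fineK (finA LX)) lee_fin.
by move/Lclosure_rho: Cm; rewrite r_shift// subr_le0; apply; exact: Lsh.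
Qed.

(** Both extensions are continuous at [X] and coincide on its truncations. *)
Lemma finite_extension_unique B C X :
  finite_extension P p%:E A B S0 ST -> finite_extension P p%:E A C S0 ST ->
  Lp P p%:E X -> rho B S0 ST X = rho C S0 ST X.
Proof.
move=> [accB cB finB BA] [accC cC finC CA] LX.
rewrite -(fineK (finB _ LX)) -(fineK (finC _ LX)); congr EFin.
have antiB := finrho_anti pe1 accB tS LSp finB.
have convB := finrho_convex pe1 accB tS LSp cB finB.
have antiC := finrho_anti pe1 accC tS LSp finC.
have convC := finrho_convex pe1 accC tS LSp cC finC.
apply/eqP; rewrite -subr_eq0 -normr_le0; apply/ler_addgt0Pr => e e0.
have e2 : 0 < e / 2 by rewrite divr_gt0.
have [dB dB0 HB] := anti_convex_continuous p1 antiB convB LX e2.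
have [dC dC0 HC] := anti_convex_continuous p1 antiC convC LX e2.
have m0 : 0 < Num.min dB dC by rewrite lt_min dB0.
have [n [Ln Xn]] := Lp_trunc_approx p1 LX m0.
pose U w := trunc n X w - X w.
have LU : Lp P p%:E U by apply: LB => //; exact: LLp.
have XU : (fun w => X w + U w) = trunc n X by apply/funext => w; rewrite /U addrC subrK.
have NU : (Np U < (Num.min dB dC)%:E)%E by move: Xn; rewrite (Ldist_sym P p).
have hB := HB U LU (lt_le_trans NU _); have hC := HC U LU (lt_le_trans NU _).
rewrite XU BA// lee_fin ge_min lexx in hB.
rewrite XU CA// lee_fin ge_min lexx orbT in hC.
move: (hB isT) (hC isT); rewrite !ler_norml => /andP[b1 b2] /andP[c1 c2].
by apply/andP; split; lra.
Qed.

End Extension.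

(** * Assembly of the equivalences and of uniqueness *)

Theorem theorem4p3 (d : measure_display) (T : measurableType d) (R : realType)
  (P : probability T R) (A : set (T -> R)) (S0 : R) (ST : T -> R) (p : R) :
  nonatomic P ->
  acceptance_set P +oo%E A -> convex_set A -> law_invariant P +oo%E A ->
  traded_asset P S0 ST -> Lp P +oo%E ST ->
  (forall X, Lp P +oo%E X -> rho A S0 ST X \is a fin_num) ->
  1 <= p ->
  let a := exists B, finite_extension P p%:E A B S0 ST in
  let b := forall Xn : nat -> T -> R, (forall n, Lp P +oo%E (Xn n)) ->
             (fun n => ('N[P]_(p%:E) [EFin \o Xn n])%E) @ \oo --> 0%E ->
             (fun n => rho A S0 ST (Xn n)) @ \oo --> rho A S0 ST (cst 0) in
  let c := has_interior P +oo%E p%:E (Lclosure P +oo%E A) in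
  let d_ := has_interior P p%:E p%:E (Lclosure P p%:E A) in
  [/\ a <-> b, b <-> c, c <-> d_ &
      a -> finite_extension P p%:E A (Lclosure P p%:E A) S0 ST /\
           forall B, finite_extension P p%:E A B S0 ST ->
             forall X, Lp P p%:E X ->
               rho B S0 ST X = rho (Lclosure P p%:E A) S0 ST X].
Proof.
move=> Pna accA cA lawA tS LS finA p1 a b c d_.
have ext : rho_bounded0 P A S0 ST p ->
    finite_extension P p%:E A (Lclosure P p%:E A) S0 ST.
  exact: bounded0_finite_extension.
have ac : a -> rho_continuous0 P A S0 ST p.
  by move=> [B] /(finite_extension_continuous0 tS LS p1).
have bb : b -> rho_bounded0 P A S0 ST p by exact: seq_bounded0.
have cb : rho_continuous0 P A S0 ST p -> b by exact: continuous0_seq.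
split.
(* The witness for the extension is always the $L^p$-closure itself. *)
- split=> [/ac/cb//|/bb/ext e]; by exists (Lclosure P p%:E A).
- split=> [/bb|]; first exact: bounded0_interior.
  by move=> hc; apply: cb; apply: interior_continuous0 hc.
- split; [exact: (interior_oo_p Pna accA cA lawA p1)|].
  exact: (interior_p_oo Pna accA cA lawA p1).
move=> /ac/continuous0_bounded0/ext e; split=> // B eB X LX.
exact: (finite_extension_unique tS LS p1 eB e LX).
Qed.
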